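(* Let $M$ be a compact, connected, boundaryless $C^\infty$ Riemannian manifold and let $f:M\to M$ be a $C^1$ Axiom A endomorphism having a repeller with nonempty interior in $M$. Then $f$ is a transitive Anosov endomorphism.
   Context: A continuous map $f:M\to M$ is transitive if for any nonempty open sets $U,V\subset M$ there is $n\ge 1$ with $f^n(U)\cap V\neq\varnothing$. A point $x$ is non-wandering if for every open neighborhood $V$ of $x$ there is $n\ge1$ with $f^n(V)\cap V\ne\varnothing$; $\Omega(f)$ is the set of non-wandering points. Let $M^f=\{(x_n)_{n\in\mathbb{Z}}\in M^{\mathbb{Z}} : f(x_n)=x_{n+1}\ \text{for all } n\in\mathbb Z\}$, with metric $\bar d(\bar x,\bar y)=\sum_{i\in\mathbb{Z}} d(x_i,y_i)/2^{|i|}$, and for $\Lambda\subset M$ let $\Lambda^f=\{(x_n)\in M^f: x_n\in\Lambda \ \text{for all } n\in\mathbb{Z}\}$. Hyperbolic set: for a $C^1$ local diffeomorphism $f$, a nonempty compact set $\Lambda$ with $f(\Lambda)=\Lambda$ is hyperbolic if there are constants $C>1$, $\lambda>1$ and, for all $\bar x=(x_n)\in\Lambda^f$, a splitting $T_{x_i}M=E^s_{x_i}\oplus E^u_{x_i}$, $i\in\mathbb{Z}$ (possibly depending on the orbit $\bar x$), which is continuous and $Df$-invariant (i.e. $Df(E^{*}_{x_i})=E^{*}_{x_{i+1}}$ for $*\in\{s,u\}$), such that for all $n>0$ and all $i$: $\|Df^n_{x_i}(v^u)\|\ge C^{-1}\lambda^n\|v^u\|$ for $v^u\in E^u_{x_i}$,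 and $\|Df^n_{x_i}(v^s)\|\le C\lambda^{-n}\|v^s\|$ for $v^s\in E^s_{x_i}$. Anosov endomorphism: a $C^1$ local diffeomorphism $f:M\to M$ for which there are constants $C>1$, $\lambda>1$ such that along every orbit $(x_n)_{n\in\mathbb Z}\in M^f$ there is a $Df$-invariant splitting $T_{x_i}M=E^s_{x_i}\oplus E^u_{x_i}$, $i\in\mathbb Z$, satisfying the same two inequalities for all $n>0$. Axiom A endomorphism: a $C^1$ local diffeomorphism $f$ such that $\Omega(f)$ is a hyperbolic set and $\overline{\mathrm{Per}(f)}=\Omega(f)$, where $\mathrm{Per}(f)$ is the set of periodic points. By the spectral decomposition theorem, for an Axiom A endomorphism $\Omega(f)$ is in a unique way a finite disjoint union of compact sets $\Omega_1,\dots,\Omega_l$ with $f(\Omega_i)=\Omega_i$ and $f|_{\Omega_i}$ transitive; the $\Omega_i$ are called the basic sets of $f$. Repeller: a basic set $B$ with $W^s(B)=B$, where $W^s(B)=\bigcup_{x\in B}W^s(x)$ and $W^s(x)=\{y\in M: d(f^n(x),f^n(y))\to0 \text{ as } n\to+\infty\}$. *)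

(* Defs.v *)
From HB Require Import structures.
From mathcomp Require Import all_boot all_order all_algebra.
From mathcomp Require Import all_classical all_reals all_analysis.
Import Order.TTheory GRing.Theory Num.Theory.
Import numFieldNormedType.Exports.

Set Implicit Arguments.
Unset Strict Implicit.
Unset Printing Implicit Defensive.

Local Open Scope classical_set_scope.
Local Open Scope ring_scope.

Section CkMaps.
Context {R : realType}.

(* Meant for an open U: f is C^k on U iff it is continuous on U and, when
   k > 0, all its directional derivatives exist and are C^(k-1) on U. *)
Fixpoint Ck_on {V W : normedModType R} (k : nat) (U : set V) (f : V -> W)
    : Prop :=
  (forall x, U x -> {for x, continuous f}) /\
  if k is k'.+1 then
    forall v : V, (forall x, U x -> derivable f x v) /\ Ck_on k' U ('D_v f)
  else True.

Definition smooth_on {V W : normedModType R} (U : set V) (f : V -> W) : Prop :=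
  forall k, Ck_on k U f.

End CkMaps.

(* A boundaryless C^oo manifold of dimension n: every chart is onto an open
   subset of R^n. The maps chart i and chart_inv i are total, but only their
   values on chart_dom i and chart_img i are meaningful. *)
Record manifold (R : realType) (n : nat) (M : topologicalType) := Manifold {
  chart_index : Type ;
  chart_dom : chart_index -> set M ;
  chart_img : chart_index -> set 'rV[R]_n ;
  chart : chart_index -> M -> 'rV[R]_n ;
  chart_inv : chart_index -> 'rV[R]_n -> M ;
  chart_at : M -> chart_index ;
  manifold_hausdorff : hausdorff_space M ;
  manifold_second_countable : @second_countable M ;
  chart_dom_open : forall i, open (chart_dom i) ;
  chart_img_open : forall i, open (chart_img i) ;
  chart_in_img : forall i x, chart_dom i x -> chart_img i (chart i x) ;
  chart_inv_in_dom :
    forall i u, chart_img i u -> chart_dom i (chart_inv i u) ;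
  chartK : forall i x, chart_dom i x -> chart_inv i (chart i x) = x ;
  chart_invK : forall i u, chart_img i u -> chart i (chart_inv i u) = u ;
  chart_continuous :
    forall i x, chart_dom i x -> {for x, continuous (chart i)} ;
  chart_inv_continuous :
    forall i u, chart_img i u -> {for u, continuous (chart_inv i)} ;
  mem_chart_at : forall x, chart_dom (chart_at x) x ;
  chart_smooth : forall i j,
    smooth_on (chart_img i `&` chart_inv i @^-1` chart_dom j)
              (chart j \o chart_inv i)
}.

Section Differential.
Context {R : realType} {n : nat} {M : topologicalType} (X : manifold R n M).

(* The tangent space at x is 'rV[R]_n, a vector being identified with its
   coordinates in the preferred chart [chart_at X x]. *)

(* The differential at x of the i-th chart, from T_x M to R^n. *)
Definition dchart (i : chart_index X) (x : M) : 'rV[R]_n -> 'rV[R]_n :=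
  'd (chart i \o chart_inv (chart_at X x)) (chart (chart_at X x) x).

(* The differential at u = chart i x of the inverse of the i-th chart, from
   R^n to T_x M, where x = chart_inv i u. *)
Definition dchart_inv (i : chart_index X) (u : 'rV[R]_n)
    : 'rV[R]_n -> 'rV[R]_n :=
  'd (chart (chart_at X (chart_inv i u)) \o chart_inv i) u.

(* The differential Df_x, from T_x M to T_(f x) M. *)
Definition mdiff (f : M -> M) (x : M) : 'rV[R]_n -> 'rV[R]_n :=
  'd (chart (chart_at X (f x)) \o f \o chart_inv (chart_at X x))
     (chart (chart_at X x) x).

Definition mC1_on (U : set M) (f : M -> M) : Prop :=
  (forall x, U x -> {for x, continuous f}) /\
  forall i j : chart_index X,
    Ck_on 1 (chart_img i `&`
             chart_inv i @^-1` (U `&` f @^-1` chart_dom j))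
            (chart j \o f \o chart_inv i).

Definition local_diffeo (f : M -> M) : Prop :=
  forall x, exists U : set M,
    [/\ open U, U x, open (f @` U), mC1_on U f &
        exists h : M -> M,
          (forall y, U y -> h (f y) = y) /\ mC1_on (f @` U) h].

(* A C^1 curve on [0, 1], given by a C^1 extension to the line. *)
Definition C1_curve (c : R -> M) : Prop :=
  continuous c /\
  forall i : chart_index X,
    Ck_on 1 ((c : R^o -> M) @^-1` chart_dom i) (chart i \o c).

Definition velocity (c : R -> M) (t : R) : 'rV[R]_n :=
  'D_1 (chart (chart_at X (c t)) \o c : R^o -> 'rV[R]_n) t.

(* s lists the C^1 pieces of a piecewise C^1 curve from x to y. *)
Fixpoint piecewise_C1 (x : M) (s : seq (R -> M)) (y : M) : Prop :=
  if s is c :: s' then [/\ C1_curve c, c 0 = x & piecewise_C1 (c 1) s' y]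
  else x = y.

End Differential.

Record riemannian (R : realType) (n : nat) (M : topologicalType)
    (X : manifold R n M) := Riemannian {
  metric : M -> 'rV[R]_n -> 'rV[R]_n -> R ;
  metric_sym : forall x u v, metric x u v = metric x v u ;
  metric_linear : forall x a u v w,
    metric x (a *: u + v) w = a * metric x u w + metric x v w ;
  metric_pos : forall x u, u != 0 -> 0 < metric x u u ;
  metric_smooth : forall (i : chart_index X) (u v : 'rV[R]_n),
    smooth_on (chart_img i)
      (fun w => metric (chart_inv i w) (dchart_inv i w u) (dchart_inv i w v)
                : R^o)
}.

Section Dynamics.
Context {R : realType} {n : nat} {M : topologicalType} {X : manifold R n M}.
Variable g : riemannian X.

Definition tnorm (x : M) (v : 'rV[R]_n) : R := Num.sqrt (metric g x v v).

Definition curve_length (c : R -> M) : R :=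
  \int[lebesgue_measure]_(t in `[0, 1]) tnorm (c t) (velocity X c t).

Definition dist (x y : M) : R :=
  inf [set \sum_(c <- s) curve_length c | s in [set s | piecewise_C1 X x s y]].

Variable f : M -> M.

Definition full_orbits (L : set M) : set (int -> M) :=
  [set x | forall k : int, f (x k) = x (k + 1) /\ L (x k)].

Definition orbit_dist (x y : int -> M) : \bar R :=
  \esum_(k in [set: int]) (dist (x k) (y k) / 2 ^+ `|k|%N)%:E.

Definition orbit_continuous_at (L : set M) (F : (int -> M) -> 'rV[R]_n)
    (x : int -> M) : Prop :=
  forall e : R, 0 < e -> exists2 d : R, 0 < d &
    forall y, full_orbits L y -> (orbit_dist x y < d%:E)%E ->
      `|F x - F y| < e.

(* E x is a subspace of the tangent space at x k. It varies continuously with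
   the orbit x when, read in a chart, it admits continuous local frames. *)
Definition continuous_subbundle (L : set M) (k : int)
    (E : (int -> M) -> {vspace 'rV[R]_n}) : Prop :=
  forall x, full_orbits L x ->
  exists (i : chart_index X) (d : R) (r : nat)
         (e : 'I_r -> (int -> M) -> 'rV[R]_n),
    0 < d /\
    forall y, full_orbits L y -> (orbit_dist x y < d%:E)%E ->
      [/\ chart_dom i (y k),
          basis_of (linfun (dchart i (y k)) @: E y)%VS
                   [seq e a y | a <- enum 'I_r] &
          forall a, orbit_continuous_at L (e a) y].

Definition hyperbolic_splitting (C lam : R) (x : int -> M)
    (Es Eu : int -> {vspace 'rV[R]_n}) : Prop :=
  forall k : int,
    [/\ (Es k + Eu k = fullv)%VS /\ (Es k :&: Eu k = 0)%VS,
        (linfun (mdiff X f (x k)) @: Es k)%VS = Es (k + 1),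
        (linfun (mdiff X f (x k)) @: Eu k)%VS = Eu (k + 1) &
        forall m : nat, (0 < m)%N ->
          (forall v, v \in Eu k ->
             C^-1 * lam ^+ m * tnorm (x k) v
               <= tnorm (iter m f (x k)) (mdiff X (iter m f) (x k) v)) /\
          (forall v, v \in Es k ->
             tnorm (iter m f (x k)) (mdiff X (iter m f) (x k) v)
               <= C * lam ^- m * tnorm (x k) v)].

Definition hyperbolic_set (L : set M) : Prop :=
  [/\ L !=set0, compact L, f @` L = L &
      exists (C lam : R) (Es Eu : (int -> M) -> int -> {vspace 'rV[R]_n}),
        [/\ 1 < C, 1 < lam,
            forall x, full_orbits L x ->
              hyperbolic_splitting C lam x (Es x) (Eu x) &
            forall k, continuous_subbundle L k (Es ^~ k) /\
                      continuous_subbundle L k (Eu ^~ k)]].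

Definition anosov : Prop :=
  local_diffeo X f /\
  exists C lam : R, [/\ 1 < C, 1 < lam &
    forall x, full_orbits [set: M] x ->
      exists Es Eu, hyperbolic_splitting C lam x Es Eu].

(* Transitivity of f restricted to the invariant set A, with its subspace
   topology; [set: M] gives transitivity of f. *)
Definition transitive_on (A : set M) : Prop :=
  forall U V : set M, open U -> open V -> U `&` A !=set0 -> V `&` A !=set0 ->
    exists m : nat, (1 <= m)%N /\
      (iter m f @` (U `&` A)) `&` (V `&` A) !=set0.

Definition nonwandering : set M :=
  [set x | forall V : set M, open V -> V x ->
     exists m : nat, (1 <= m)%N /\ (iter m f @` V) `&` V !=set0].

Definition periodic_points : set M :=
  [set x | exists m : nat, (1 <= m)%N /\ iter m f x = x].

Definition axiomA : Prop :=
  [/\ local_diffeo X f, hyperbolic_set nonwandering &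
      closure periodic_points = nonwandering].

(* The pieces are required to be nonempty, which is needed for the uniqueness
   of the decomposition. *)
Definition spectral_decomposition (l : nat) (Om : 'I_l -> set M) : Prop :=
  [/\ nonwandering = \bigcup_(i in [set: 'I_l]) Om i,
      forall i j, i != j -> Om i `&` Om j = set0 &
      forall i, [/\ Om i !=set0, compact (Om i), f @` Om i = Om i &
                    transitive_on (Om i)]].

Definition basic_set (B : set M) : Prop :=
  exists (l : nat) (Om : 'I_l -> set M),
    spectral_decomposition Om /\ exists i, B = Om i.

Definition stable_set (x : M) : set M :=
  [set y | (fun m : nat => dist (iter m f x) (iter m f y)) @ \oo --> (0 : R)].

Definition repeller (B : set M) : Prop :=
  basic_set B /\ \bigcup_(x in B) stable_set x = B.

End Dynamics.

(* Main.v *)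
From HB Require Import structures.
Require Import Defs.
From mathcomp Require Import all_boot all_order all_algebra.
From mathcomp Require Import all_classical all_reals all_analysis.
From mathcomp Require Import ring lra zify.
Import Order.TTheory GRing.Theory Num.Theory.
Import numFieldNormedType.Exports.

(** Since [M] is connected and a basic set is compact, a repeller [B] is all
    of [M] as soon as it is open. Then every point is nonwandering, and the
    hyperbolic splitting of the nonwandering set and the transitivity of [f]
    on [B] are the two conclusions. All the work is the openness of [B]
    ([repeller_nbhs]).

    Let [z] be a point of [B] and [y] a point near [z]. As [B] contains the
    stable sets of its points, it suffices to find [w] in [B] whose forward
    orbit is asymptotic to that of [y]. Fix a large iterate [F] of [f]. By
    transitivity some [x], so far inside [B] that a ball of fixed size around
    it lies in [B], satisfies [F^q x] near [z], hence near [y]. The sequence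
      [x, F x, ..., F^q x, F y, F^2 y, ...]
    is a pseudo-orbit with one small jump. An exact orbit follows it, at
    distance at most [rho] up to time [q] and at most [rho / 2^j] at time
    [q + j] ([shadow_one_jump]). It starts near [x], hence in [B], so it never
    leaves the invariant set [B], and from time [q] on it is asymptotic to the
    orbit of [y].

    Shadowing needs hyperbolicity along the pseudo-orbit, whereas the orbit of
    [y] is not known to stay near [B]. The argument is therefore run on finite
    pieces, by induction on their length: the shadow of the first [m] steps
    after the jump is an orbit in [B] close to that of [y], and hyperbolicity
    along it is enough to shadow one step more. A limit point of the finite
    shadows is the required [w] ([limit_shadow]).

    The shadowing orbit is the fixed point of a contraction on finite sequences
    in charts, whose stable coordinates are computed forwards in time and the
    unstable ones backwards ([shadowing]). For an endomorphism the unstable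
    space depends on the whole past of an orbit, so two hyperbolic orbits that
    pass close to each other carry unrelated unstable spaces. However, any
    unstable space is sent by the derivative of [F] close to any other one, as
    soon as the angles between stable and unstable spaces are bounded below
    and the rates of [F] are strong ([graph_transform]). *)

Set Implicit Arguments.
Unset Strict Implicit.
Unset Printing Implicit Defensive.

Local Open Scope classical_set_scope.
Local Open Scope ring_scope.

(** * Strict differentiability *)

Section VectorNorm.
Context {R : realType}.

Lemma coord_le_norm (m n : nat) (A : 'M[R]_(m, n)) i j : `|A i j| <= `|A|.
Proof.
rewrite [leRHS]/Num.Def.normr /= mx_normrE.
exact: (le_bigmax _ (fun ij : 'I_m * 'I_n => `|A ij.1 ij.2|) (i, j)).
Qed.

Lemma norm_le_coord (m n : nat) (A : 'M[R]_(m, n)) (b : R) :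
  0 <= b -> (forall i j, `|A i j| <= b) -> `|A| <= b.
Proof.
move=> b0 Ab; rewrite [leLHS]/Num.Def.normr /= mx_normrE.
by apply: bigmax_le => // -[i j] _; exact: Ab.
Qed.

Lemma linear_bound (n : nat) (W : normedModType R)
    (f : {linear 'rV[R]_n -> W}) :
  exists2 k : R, 0 < k & forall v, `|f v| <= k * `|v|.
Proof.
exists (1 + \sum_(j < n) `|f (delta_mx 0 j)|).
  by rewrite ltr_pwDl// sumr_ge0.
move=> v; rewrite {1}[v]row_sum_delta raddf_sum/=.
apply: (le_trans (ler_norm_sum _ _ _)).
rewrite mulrDl mul1r ler_wpDl// mulr_suml ler_sum// => j _.
by rewrite linearZ/= normrZ mulrC ler_wpM2l// coord_le_norm.
Qed.

Lemma linear_rV_continuous (n : nat) (W : normedModType R)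
    (f : {linear 'rV[R]_n -> W}) : continuous f.
Proof.
apply: bounded_linear_continuous; apply/linear_boundedP.
have [k k0 fk] := linear_bound f.
near=> r => x; apply: (le_trans (fk x)); apply: ler_wpM2r => //.
Unshelve. all: by end_near. Qed.

End VectorNorm.

Section StrictDifferentiability.
Context {R : realType}.

(** For maps that are [C^1] near [u] this is the mean value inequality with a
    constant as small as desired. It is the only consequence of [C^1]
    regularity that shadowing requires, and it composes more easily than the
    continuity of partial derivatives. *)
Definition strictly_differentiable (n m : nat)
    (H : 'rV[R]_n -> 'rV[R]_m) (u : 'rV[R]_n) : Prop :=
  differentiable H u /\
  forall e : R, 0 < e -> exists2 r : R, 0 < r &
    forall v v', `|v - u| <= r -> `|v' - u| <= r ->
      `|H v - H v' - 'd H u (v - v')| <= e * `|v - v'|.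

Lemma strictly_differentiable_of_linear (n m : nat)
    (H : 'rV[R]_n -> 'rV[R]_m) (u : 'rV[R]_n)
    (A : {linear 'rV[R]_n -> 'rV[R]_m}) :
  (forall e : R, 0 < e -> exists2 r : R, 0 < r &
    forall v v', `|v - u| <= r -> `|v' - u| <= r ->
      `|H v - H v' - A (v - v')| <= e * `|v - v'|) ->
  strictly_differentiable H u /\ 'd H u = A :> (_ -> _).
Proof.
move=> HA.
have HAo : H \o shift u = cst (H u) + A +o_ (0 : 'rV[R]_n) id.
  apply/(@eqaddoP R 'rV[R]_n 'rV[R]_m 'rV[R]_n) => e e0; have [r r0 Hr] := HA e e0.
  have hr : \forall h \near (0 : 'rV[R]_n), `|h| <= r by exact: nbhs0_le.
  apply: filterS hr => h hr; have := Hr (h + u) u; rewrite subrr normr0 addrK => /(_ _ (ltW r0)).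
  rewrite -[(_ - _) h]/((H (h + u)) - (H u + A h)) opprD addrA; exact.
have dE : 'd H u = A :> (_ -> _).
  by apply: diff_unique => //; exact: linear_rV_continuous.
split; last exact: dE.
split; last by move=> e e0; have [r r0 Hr] := HA e e0; exists r => //; rewrite dE.
apply/diff_locallyP; rewrite dE; split => //; exact: linear_rV_continuous.
Qed.

Lemma strictly_differentiable_lipschitz (n m : nat)
    (H : 'rV[R]_n -> 'rV[R]_m) (u : 'rV[R]_n) :
  strictly_differentiable H u ->
  exists L r : R, [/\ 0 < L, 0 < r & forall v v', `|v - u| <= r ->
    `|v' - u| <= r -> `|H v - H v'| <= L * `|v - v'|].
Proof.
move=> [_ Hu]; have [k k0 Hk] := linear_bound ('d H u).
have [r r0 Hr] := Hu 1 ltr01.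
exists (1 + k), r; split => //; first by rewrite addr_gt0.
move=> v v' vr v'r; rewrite -[H v - H v'](subrK ('d H u (v - v'))).
by rewrite mulrDl (le_trans (ler_normD _ _))// lerD// Hr.
Qed.

Lemma strictly_differentiable_comp (n m p : nat) (H : 'rV[R]_n -> 'rV[R]_m)
    (G : 'rV[R]_m -> 'rV[R]_p) (u : 'rV[R]_n) :
  strictly_differentiable H u -> strictly_differentiable G (H u) ->
  strictly_differentiable (G \o H) u.
Proof.
move=> Hs Gs; have [L [s [L0 s0 HL]]] := strictly_differentiable_lipschitz Hs.
have [Hd Hu] := Hs; have [Gd Gu] := Gs.
split; first exact: differentiable_comp.
move=> e e0; have [k k0 Gk] := linear_bound ('d G (H u)).
have eL : 0 < e / 2 / L by rewrite !divr_gt0.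
have ek : 0 < e / 2 / k by rewrite !divr_gt0.
have [r r0 Gr] := Gu _ eL; have [t t0 Ht] := Hu _ ek.
pose w := Num.min (Num.min s t) (r / L).
have w0 : 0 < w by rewrite !lt_min s0 t0 divr_gt0.
have wr : w <= r / L by rewrite ge_min lexx orbT.
have ws : w <= s by rewrite !ge_min lexx.
have wt : w <= t by rewrite !ge_min lexx orbT.
have inr v : `|v - u| <= w -> `|H v - H u| <= r.
  move=> vw; apply: (le_trans (HL v u (le_trans vw ws) _)).
    by rewrite subrr normr0 ltW.
  by rewrite mulrC -ler_pdivlMr// (le_trans vw wr).
exists w => // v v' vw v'w.
rewrite diff_comp//= -[X in X <= _]/(`|G (H v) - G (H v') - _|).
rewrite -(subrK ('d G (H u) (H v - H v')) (G (H v) - G (H v'))) -addrA -linearB.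
rewrite [X in X * _](splitr e) mulrDl (le_trans (ler_normD _ _))// lerD//.
  apply: (le_trans (Gr _ _ (inr _ vw) (inr _ v'w))).
  rewrite -mulrA ler_wpM2l ?(ltW (divr_gt0 _ _))// ler_pdivrMl// mulrC.
  by rewrite mulrC HL// (le_trans _ ws).
apply: (le_trans (Gk _)); rewrite mulrC -ler_pdivlMr//.
by rewrite mulrAC Ht// (le_trans _ wt).
Qed.

(** The mean value theorem on the line through [p] directed by [w], for each
    coordinate of [H]. The values of [t] are taken on both sides of 0 so that
    the sign of [c] does not matter. *)
Lemma increment_bound (V : normedModType R) (m : nat) (H : V -> 'rV[R]_m)
    (p w : V) (D : 'rV[R]_m) (c e : R) :
  (forall t : R, `|t| <= `|c| -> derivable H (t *: w + p) w /\
     `|'D_w H (t *: w + p) - D| <= e) ->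
  `|H (c *: w + p) - H p - c *: D| <= e * `|c|.
Proof.
move=> Hc.
have e0 : 0 <= e by have [] := Hc 0 => [|_]; [rewrite normr0|exact: le_trans].
apply: norm_le_coord; first by rewrite mulr_ge0.
move=> i j; rewrite !mxE.
pose g (t : R) : R := H (t *: w + p) i j.
have gd (t : R) : `|t| <= `|c| -> is_derive t 1 g ('D_w H (t *: w + p) i j).
  move=> tc; have [Hd _] := Hc t tc.
  have Hij : is_derive (t *: w + p) w (fun v => H v i j) ('D_w H (t *: w + p) i j).
    apply: DeriveDef; first by move/derivable_mxP : Hd; apply.
    by rewrite derive_mx// mxE.
  have shE : (fun h : R => h^-1 *: (((fun v => H v i j) \o shift (t *: w + p)) (h *: w)
      - (fun v => H v i j) (t *: w + p))) =
      (fun h : R => h^-1 *: ((g \o shift t) (h *: (1 : R)) - g t)).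
    apply/funext => h /=; congr (_ *: (_ - _)).
    by rewrite /g [h *: 1]mulr1 scalerDl addrA.
  case: Hij => Hij1 Hij2; split.
    by rewrite /derivable -shE.
  by rewrite /derive -shE.
have gc : forall a b : R, `|a| <= `|c| -> `|b| <= `|c| ->
    {within `[a, b], continuous g}.
  move=> a b ac bc; apply: derivable_within_continuous => t.
  rewrite in_itv/= => /andP[ta tb].
  have tc : `|t| <= `|c|.
    move: ac bc; rewrite !ler_norml => /andP[a1 a2] /andP[b1 b2].
    by rewrite (le_trans a1 ta) (le_trans tb b2).
  by have [] := gd t tc.
have key : exists2 s, `|s| <= `|c| & g c - g 0 = 'D_w H (s *: w + p) i j * c.
  have [c0|c0] := leP 0 c.
    have [||s] := @MVT_segment R g (fun t => 'D_w H (t *: w + p) i j) 0 c c0.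
    - move=> x; rewrite in_itv/= => /andP[x0 xc]; apply: gd.
      by rewrite !ger0_norm// ltW.
    - by apply: gc; rewrite ?normr0.
    rewrite in_itv/= => /andP[s0 sc] ->; exists s; rewrite ?subr0//.
    by rewrite !ger0_norm.
  have [||s] := @MVT_segment R g (fun t => 'D_w H (t *: w + p) i j) c 0 (ltW c0).
  - move=> x; rewrite in_itv/= => /andP[x0 xc]; apply: gd.
    by rewrite !ltr0_norm// lerN2 ltW.
  - by apply: gc; rewrite ?normr0.
  rewrite in_itv/= => /andP[cs sc] E; exists s.
    by rewrite (ltr0_norm c0) (ler0_norm sc) lerN2.
  by rewrite -[LHS]opprB E sub0r mulrN opprK.
have [s sc gs] := key.
rewrite -[X in `|X - _ - _|]/(g c).
have -> : H p i j = g 0 by rewrite /g scale0r add0r.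
rewrite gs mulrC -mulrBr normrM mulrC ler_wpM2r//.
have [_] := Hc s sc; apply: le_trans.
by have := coord_le_norm ('D_w H (s *: w + p) - D) i j; rewrite !mxE.
Qed.

(** Going from [v'] to [v] by changing one coordinate at a time, each step is
    controlled by [increment_bound] for the corresponding partial derivative,
    which is close to its value at [u]. *)
Lemma Ck1_strictly_differentiable (n m : nat) (U : set 'rV[R]_n)
    (H : 'rV[R]_n -> 'rV[R]_m) (u : 'rV[R]_n) :
  open U -> Ck_on 1 U H -> U u -> strictly_differentiable H u.
Proof.
move=> oU [_ HC] Uu.
pose J := \matrix_(j < n, i < m) 'D_(delta_mx 0 j) H u 0 i.
suff HA e : 0 < e -> exists2 r : R, 0 < r &
    forall v v', `|v - u| <= r -> `|v' - u| <= r ->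
      `|H v - H v' - mulmxr J (v - v')| <= e * `|v - v'|.
  by have [] := strictly_differentiable_of_linear HA.
move=> e0; pose e' := e / n.+1%:R.
have e'0 : 0 < e' by rewrite divr_gt0.
have : \forall v \near u, U v /\ forall j : 'I_n,
    `|'D_(delta_mx 0 j) H v - 'D_(delta_mx 0 j) H u| <= e'.
  apply: filterI; first by move: (oU); rewrite openE; exact.
  apply: (@filter_forall _ _ (fun (j : 'I_n) v =>
    `|'D_(delta_mx 0 j) H v - 'D_(delta_mx 0 j) H u| <= e') (nbhs u)) => j.
  have [_ [Hcont _]] := HC (delta_mx 0 j).
  have hc : \forall v \near u,
      `|'D_(delta_mx 0 j) H u - 'D_(delta_mx 0 j) H v| <= e'.
    exact: (cvgr_dist_le _ _ (Hcont u Uu)).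
  near=> v.
  rewrite distrC.
  near: v.
  exact: hc.
move=> /nbhs_closedballP[rp Hr]; set r : R := rp%:num in Hr.
have r0 : 0 < r by rewrite /r.
have {}Hr v : `|v - u| <= r -> U v /\ forall j : 'I_n,
    `|'D_(delta_mx 0 j) H v - 'D_(delta_mx 0 j) H u| <= e'.
  move=> vr; apply: Hr; rewrite /= closed_ballE//.
  by have : `|u - v| <= r by rewrite distrC.
(* The mean value estimate looks at both sides of its starting point, so it
   reaches points that are up to three times as far from u as v and v'. *)
exists (r / 3); first by rewrite divr_gt0.
move=> v v' vr v'r.
pose p (k : nat) : 'rV[R]_n := \row_i (if (i < k)%N then v 0 i else v' 0 i).
have p0 : p 0%N = v' by apply/rowP => i; rewrite mxE.
have pn : p n = v by apply/rowP => i; rewrite mxE ltn_ord.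
have pS (k : 'I_n) : p k.+1 = (v 0 k - v' 0 k) *: delta_mx 0 k + p k.
  apply/rowP => i; rewrite !mxE/= ltnS leq_eqVlt -val_eqE/=.
  have [/val_inj ->|] /= := eqVneq (i : nat) k; first by rewrite ltnn mulr1 subrK.
  by rewrite mulr0 add0r.
have Js : mulmxr J (v - v') =
    \sum_(k < n) (v 0 k - v' 0 k) *: 'D_(delta_mx 0 k) H u.
  apply/rowP => i; rewrite /= mxE summxE; apply: eq_bigr => k _.
  by rewrite !mxE.
have Hs : H v - H v' = \sum_(k < n) (H (p k.+1) - H (p k)).
  rewrite -pn -p0 -(telescope_sumr (fun k => H (p k)) (leq0n n)).
  by rewrite big_mkord.
rewrite Hs Js -sumrB (le_trans (ler_norm_sum _ _ _))//.
apply: (@le_trans _ _ (\sum_(k < n) e' * `|v - v'|)).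
  apply: ler_sum => k _; rewrite pS.
  apply: (@le_trans _ _ (e' * `|v 0 k - v' 0 k|)).
    apply: increment_bound => t tk.
    have pr : `|t *: delta_mx 0 k + p k - u| <= r.
      apply: norm_le_coord; first exact: ltW.
      move=> i0 i; rewrite ord1 !mxE/=.
      have vi : `|v 0 i - u 0 i| <= r / 3.
        by have := coord_le_norm (v - u) 0 i; rewrite !mxE => /le_trans; apply.
      have v'i : `|v' 0 i - u 0 i| <= r / 3.
        by have := coord_le_norm (v' - u) 0 i; rewrite !mxE => /le_trans; apply.
      have r3 : r / 3 <= r by rewrite ler_pdivrMr// ler_peMr ?(ltW r0)// ler1n.
      have [ik|ik] /= := eqVneq i k; last first.
        by rewrite mulr0 add0r; case: ifP => _; apply: (le_trans _ r3).
      move: tk; rewrite ik ltnn mulr1 -{}ik => tk.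
      rewrite -addrA (le_trans (ler_normD _ _))//.
      rewrite (_ : r = (r / 3 + r / 3) + r / 3); last by field.
      rewrite lerD// (le_trans tk)// -(subrKA (u 0 i)) (le_trans (ler_normD _ _))//.
      by rewrite lerD// distrC.
    have [Up Hk] := Hr _ pr; split; last exact: Hk.
    by have [Hd _] := HC (delta_mx 0 k); exact: Hd.
  apply: ler_wpM2l; first exact: ltW.
  by have := coord_le_norm (v - v') 0 k; rewrite !mxE.
rewrite -mulr_suml ler_wpM2r// sumr_const card_ord -mulr_natr /e'.
by rewrite -mulrA ger_pMr// ler_pdivrMl// mulr1 ler_nat.
Unshelve. all: by end_near. Qed.
End StrictDifferentiability.

(** * Pairs of complementary subspaces *)

Section SplittingAlgebra.
Context {R : realType} {n : nat}.
Local Notation V := 'rV[R]_n.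
Implicit Types (A : 'End(V)) (U S : {vspace V}).

(** The inequality says that the angle between [U] and [S] is bounded below:
    the projection onto [U] along [S] has norm at most [K]. *)
Definition transverse (K : R) U S : Prop :=
  [/\ (U + S = fullv)%VS, (U :&: S = 0)%VS &
      forall u s, u \in U -> s \in S -> `|u| <= K * `|u + s|].

Lemma transverse_proj K U S v : transverse K U S ->
  [/\ daddv_pi U S v \in U, v - daddv_pi U S v \in S &
      `|daddv_pi U S v| <= K * `|v|].
Proof.
move=> [US0 US1 USK].
have vE : daddv_pi U S v + daddv_pi S U v = v.
  by apply: daddv_pi_add => //; rewrite US0 memvf.
have vS : v - daddv_pi U S v = daddv_pi S U v by rewrite -{1}vE addrC addKr.
rewrite vS !memv_pi; split => //.
by rewrite -{2}vE USK// memv_pi.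
Qed.

Lemma transverse_proj_compl K U S v : 1 <= K -> transverse K U S ->
  `|v - daddv_pi U S v| <= 2 * K * `|v|.
Proof.
move=> K1 /(@transverse_proj _ _ _ v)[_ _ vK].
rewrite (le_trans (ler_normB _ _))// -mulrA mulr2n mulrDl !mul1r lerD//.
by rewrite ler_peMl.
Qed.

Lemma transverse_proj_add K U S u s : transverse K U S ->
  u \in U -> s \in S -> daddv_pi U S (u + s) = u.
Proof.
move=> [_ US1 _] uU sS; rewrite linearD/= daddv_pi_id//.
rewrite (_ : daddv_pi U S s = 0) ?addr0//.
have SU0 : (S :&: U = 0)%VS by rewrite capvC.
have := @daddv_pi_add _ _ U S s US1; rewrite (daddv_pi_id SU0)// => /(_ _).
move=> /(_ (subvP (addvSr U S) _ sS)) /eqP; rewrite -subr_eq0 addrK => /eqP.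
exact.
Qed.

(** Here [A] is the derivative along an orbit whose splitting goes from
    [U', S'] to [U'', S''], and [B] the derivative along another orbit that
    passes nearby with splitting [U, S], so that [A] and [B] are close. On [U]
    the map [A] expands almost as strongly as [B], and its component along [S''] is
    small: what a vector of [U] has along [U'] is sent into [U''], and the rest
    is contracted. Hence the composite of [A] and of the projection onto [U'']
    is injective on [U]. It is onto [U''] because [U] is at least as large as
    [U'']: the projection onto [U] along [S] is injective on [U'], as [A]
    expands [U'] and contracts [S]. The inverse of that composite, extended by
    zero along [S''], is [g]. *)
Lemma graph_transform K L (e : R) (A B : 'End(V)) U S U' S' U'' S'' :
  1 <= K -> 0 < e -> 4 * K * e <= 1 -> 2 * K <= e * L ->
  transverse K U S -> transverse K U' S' -> transverse K U'' S'' ->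
  (A @: U' = U'')%VS -> (A @: S' <= S'')%VS ->
  (forall v, `|A v - B v| <= e * `|v|) ->
  (forall v, v \in S -> `|B v| <= e * `|v|) ->
  (forall v, v \in U -> L * `|v| <= `|B v|) ->
  (forall v, v \in S' -> `|A v| <= e * `|v|) ->
  (forall v, v \in U' -> L * `|v| <= `|A v|) ->
  exists g : 'End(V), let P := daddv_pi U S in let P'' := daddv_pi U'' S'' in
  [/\ forall v, P (g v) = g v,
      forall v, g v = 0 -> P'' v = 0,
      forall v, `|g v| <= e * `|v|,
      forall v, `|A v - P'' (A v)| <= 10 * K * K * e * `|v| &
      forall v, `|P v - g (A v)| <= e * `|v| ].
Proof.
move=> K1 e0 eK eL tr tr' tr'' AU' AS' AB BS BU AS AU.
set P := daddv_pi U S; set P'' := daddv_pi U'' S''.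
have K0 : 0 < K by exact: lt_le_trans K1.
have e1 : 4 * e <= 1.
  by have : e * 1 <= e * K; [rewrite ler_pM2l | lra].
have L8 : 8 * K * K <= L.
  rewrite -(ler_pM2l e0) (le_trans _ eL)// (_ : e * _ = (4 * K * e) * (2 * K)).
    by rewrite ler_piMl// mulr_ge0// ltW.
  by ring.
have KK1 : 1 <= K * K by rewrite mulr_ege1.
have L0 : 0 < L by apply: lt_le_trans L8; rewrite !mulr_gt0.
have Le : e + 2 * K * e <= L / 2.
  rewrite ler_pdivlMr//; apply: le_trans L8.
  nra.
have As s : s \in S -> `|A s| <= 2 * e * `|s|.
  move=> sS; rewrite -(subrK (B s) (A s)) (le_trans (ler_normD _ _))//.
  by rewrite -mulrA mulr2n mulrDl !mul1r lerD// BS.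
have PAu u : u \in U ->
    P'' (A u) \in U'' /\ `|A u - P'' (A u)| <= 2 * K * e * `|u|.
  move=> uU; have [u'U s'S _] := transverse_proj u tr'.
  set u' := daddv_pi U' S' u in u'U s'S *.
  have -> : A u = A u' + A (u - u') by rewrite -linearD/= addrC subrK.
  have Au' : A u' \in U'' by rewrite -AU' memv_img.
  have As' : A (u - u') \in S'' by apply: (subvP AS'); rewrite memv_img.
  rewrite (transverse_proj_add tr'' Au' As'); split => //.
  rewrite addrAC subrr add0r (le_trans (AS _ s'S))// mulrAC [leRHS]mulrC.
  by rewrite ler_pM2l// (transverse_proj_compl u K1 tr').
have lowu u : u \in U -> L / 2 * `|u| <= `|P'' (A u)|.
  move=> uU; have [_ QA] := PAu u uU.
  have BA : `|B u| <= `|A u| + e * `|u|.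
    rewrite -[B u](subrK (A u)) addrC (le_trans (ler_normD _ _))// lerD//.
    by rewrite distrC.
  have AP : `|A u| <= `|P'' (A u)| + 2 * K * e * `|u|.
    rewrite -[X in `|X| <= _](subrK (P'' (A u))) addrC (le_trans (ler_normD _ _))//.
    by rewrite lerD.
  have := BU u uU => LB.
  have : (e + 2 * K * e) * `|u| <= L / 2 * `|u| by rewrite ler_wpM2r.
  lra.
have U'S v : v \in U' -> v \in S -> v = 0.
  move=> vU' vS; apply/normr0_eq0/eqP; rewrite eq_le normr_ge0 andbT.
  have h1 := AU v vU'; have h2 := As v vS.
  have : (L - 2 * e) * `|v| <= 0 by lra.
  rewrite pmulr_rle0// subr_gt0.
  have : e * 1 <= e * K by rewrite ler_pM2l.
  lra.
have capP : (U' :&: lker P = 0)%VS.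
  apply/eqP; rewrite -subv0; apply/subvP => v; rewrite memv_cap memv0 memv_ker.
  move=> /andP[vU' /eqP Pv0]; apply/eqP/U'S => //.
  by have [_] := transverse_proj v tr; rewrite -/P Pv0 subr0.
have dimU : (\dim U'' <= \dim U)%N.
  rewrite -AU'; apply: (@leq_trans (\dim U')).
    by rewrite -(limg_ker_dim A U') leq_addl.
  rewrite -(limg_dim_eq capP); apply: dimvS.
  by apply/subvP => _ /memv_imgP[w _ ->]; rewrite memv_pi.
pose h := (P'' \o A \o P)%VF.
have PE u : u \in U -> P u = u by case: tr => _ US _; exact: daddv_pi_id.
have hE u : u \in U -> h u = P'' (A u).
  by move=> uU; rewrite /h !comp_lfunE PE.
have caph : (U :&: lker h = 0)%VS.
  apply/eqP; rewrite -subv0; apply/subvP => v; rewrite memv_cap memv0 memv_ker.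
  move=> /andP[vU]; rewrite hE// => /eqP hv.
  have := lowu v vU; rewrite hv normr0 pmulr_rle0 ?divr_gt0//.
  by rewrite normr_le0.
have hU : (h @: U = U'')%VS.
  apply/eqP; rewrite eqEdim limg_dim_eq// dimU andbT.
  by apply/subvP => _ /memv_imgP[w _ ->]; rewrite /h !comp_lfunE memv_pi.
pose g := (P \o h^-1 \o P'')%VF.
have Ph v : h (P v) = h v.
  by rewrite /h !comp_lfunE daddv_pi_proj//; case: tr.
have gE v : g v = P ((h^-1)%VF (P'' v)) by rewrite /g !comp_lfunE.
have gU v : g v \in U by rewrite gE memv_pi.
have PAg v : P'' (A (g v)) = P'' v.
  rewrite -hE// gE Ph limg_lfunVK//.
  have : P'' v \in (h @: U)%VS by rewrite hU memv_pi.
  by apply: subvP; exact: limgS (subvf _).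
have gK v : `|g v| <= e * `|v|.
  have := lowu _ (gU v); rewrite PAg => gL.
  have [_ _ vK] := transverse_proj v tr''.
  have gv : L / 2 * `|g v| <= K * `|v| by exact: le_trans gL vK.
  rewrite -(@ler_pM2l _ (L / 2)) ?divr_gt0// (le_trans gv)//.
  rewrite mulrA ler_wpM2r// mulrAC ler_pdivlMr// mulrC [leRHS]mulrC.
  by rewrite mulrC (mulrC K).
have gA u : u \in U -> g (A u) = u.
  move=> uU; apply/eqP; rewrite -subr_eq0 -normr_le0.
  have dU : g (A u) - u \in U by rewrite rpredB.
  have := lowu _ dU; rewrite !linearB/= PAg subrr normr0 pmulr_rle0//.
  by rewrite divr_gt0.
exists g; split => //.
- by move=> v; rewrite PE.
- by move=> v gv; rewrite -PAg gv !linear0.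
- move=> v; have [PvU QvS PvK] := transverse_proj v tr.
  have Qv := transverse_proj_compl v K1 tr; rewrite -/P in PvU QvS PvK Qv.
  have [_ h1] := PAu _ PvU.
  have h2 := transverse_proj_compl (A (v - P v)) K1 tr''.
  have h3 := As _ QvS; rewrite -/P'' in h2.
  have -> : A v - P'' (A v) = (A (P v) - P'' (A (P v))) +
      (A (v - P v) - P'' (A (v - P v))).
    by rewrite addrACA -opprD -!linearD/= (addrC (P v)) subrK.
  rewrite (le_trans (ler_normD _ _))//.
  have a1 : 2 * K * e * `|P v| <= 2 * K * e * (K * `|v|).
    by rewrite ler_wpM2l// !mulr_ge0// ltW.
  have a2 : 2 * K * `|A (v - P v)| <= 2 * K * (2 * e * (2 * K * `|v|)).
    apply: ler_wpM2l; first by rewrite mulr_ge0// ltW.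
    apply: (le_trans h3); apply: ler_wpM2l => //.
    by rewrite mulr_ge0// ltW.
  lra.
- move=> v; have [PvU QvS PvK] := transverse_proj v tr.
  have Qv := transverse_proj_compl v K1 tr; rewrite -/P in PvU QvS PvK Qv.
  have -> : P v - g (A v) = - g (A (v - P v)).
    have -> : g (A (v - P v)) = g (A v) - P v by rewrite !linearB/= (gA (P v)).
    by rewrite opprB.
  rewrite normrN (le_trans (gK _))// ler_pM2l// (le_trans (As _ QvS))//.
  have a2 : 2 * e * `|v - P v| <= 2 * e * (2 * K * `|v|).
    by apply: ler_wpM2l => //; rewrite mulr_ge0// ltW.
  rewrite (le_trans a2)// !mulrA (_ : 2 * e * 2 * K = 4 * K * e); last by ring.
  by rewrite ler_piMl.
Qed.
End SplittingAlgebra.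

(** * Shadowing of finite pseudo-orbits in coordinates *)

HB.instance Definition _ (R : realType) (m n : nat) :=
  Complete.on 'M[R]_(m, n).

Section Shadowing.
Context {R : realType} {n : nat}.
Local Notation V := 'rV[R]_n.

(** A sequence [c k + x k] is an orbit of the maps [H k] if and only if the
    defects [H k (c k + x k) - (c k.+1 + x k.+1)] vanish. Their components along
    the stable spaces (the kernels of the [P k.+1]) give [x k.+1] from [x k],
    and their components along the unstable spaces, after the near-inverse
    [g k] of the expanding part, give [x k] from [x k.+1]. Both recipes
    contract, so the map [T] that applies them has a fixed point. The errors
    [rho k] may vary by a factor at most 2 at each step, which is how a shadow
    gets exponentially closer to the pseudo-orbit after the last jump. *)
Lemma shadowing (m : nat) (H : nat -> V -> V) (c : nat -> V)
    (P g : nat -> 'End(V)) (rho : nat -> R) (e : R) :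
  0 < e -> e * 8 <= 1 ->
  (forall k, 0 <= rho k) ->
  (forall k, rho k <= 2 * rho k.+1) -> (forall k, rho k.+1 <= 2 * rho k) ->
  (forall k v, (k <= m)%N -> P k (P k v) = P k v) ->
  (forall k v, (k < m)%N -> P k (g k v) = g k v) ->
  (forall k v, (k < m)%N -> g k v = 0 -> P k.+1 v = 0) ->
  (forall k v, (k < m)%N -> `|g k v| <= e * `|v|) ->
  (forall k v v', (k < m)%N -> `|v - c k| <= rho k -> `|v' - c k| <= rho k ->
     `|(H k v - H k v') - P k.+1 (H k v - H k v')| <= e * `|v - v'|) ->
  (forall k v v', (k < m)%N -> `|v - c k| <= rho k -> `|v' - c k| <= rho k ->
     `|P k (v - v') - g k (H k v - H k v')| <= e * `|v - v'|) ->
  (forall k, (k < m)%N -> `|(H k (c k) - c k.+1) - P k.+1 (H k (c k) - c k.+1)|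
     <= e * rho k.+1) ->
  (forall k, (k < m)%N -> `|g k (H k (c k) - c k.+1)| <= e * rho k) ->
  exists z : nat -> V, (forall k, (k <= m)%N -> `|z k - c k| <= rho k) /\
    (forall k, (k < m)%N -> z k.+1 = H k (z k)).
Proof.
move=> e0 e8 rho0 rho1 rho2 PP Pg ginj gK HQ HP jQ jP.
pose Q k v := v - P k v.
have vec1 (a b d y : V) : d + y - a = y - (a - b) - (b - d).
  by rewrite -[RHS]addrA -opprD subrKA opprB addrCA addrA.
have vec3 (a b d y : V) : a - b - (d - y) = a - d - (b - y).
  by rewrite !opprB [LHS]addrACA [RHS]addrACA (addrC (- b)).
have vec2 (a b d y : V) : a + (b - d - y) = (a - d) + (b - y).
  by rewrite (addrAC b) addrCA addrC.
have QD k v w : Q k (v + w) = Q k v + Q k w.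
  by rewrite /Q linearD/= opprD addrACA.
have QB k v w : Q k (v - w) = Q k v - Q k w.
  by rewrite /Q linearB/= vec3.
have PQ k v : (k <= m)%N -> P k (Q k v) = 0.
  by move=> km; rewrite /Q linearB/= PP// subrr.
(* A finite sequence of vectors is a matrix with one row for each time, in
   order to live in a complete normed space. The initial stable component and
   the final unstable one are not determined by the orbit equations and are set
   to 0. *)
pose x (M : 'M[R]_(m.+1, n)) (k : nat) : V := row (inord k) M.
pose st (M : 'M[R]_(m.+1, n)) (k : nat) : V :=
  if k is k'.+1 then Q k (H k' (c k' + x M k') - c k) else 0.
pose un (M : 'M[R]_(m.+1, n)) (k : nat) : V :=
  if (k < m)%N then P k (x M k) + g k (c k.+1 + x M k.+1 - H k (c k + x M k))
  else 0.
pose T (M : 'M[R]_(m.+1, n)) : 'M[R]_(m.+1, n) :=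
  \matrix_(i < m.+1) (st M i + un M i).
have xT M k : (k <= m)%N -> x (T M) k = st M k + un M k.
  by move=> km; rewrite /x rowK inordK.
pose W : set 'M[R]_(m.+1, n) := [set M | forall k, (k <= m)%N -> `|x M k| <= rho k].
have cx M k : W M -> (k <= m)%N -> `|c k + x M k - c k| <= rho k.
  by move=> WM km; rewrite addrAC subrr add0r WM.
have cc k : `|c k - c k| <= rho k by rewrite subrr normr0.
have TW : {homo T : M / W M >-> W M}.
  move=> M WM k km; rewrite xT// (le_trans (ler_normD _ _))//.
  have s1 : `|st M k| <= 3 * e * rho k.
    case: k km => [|k] km; first by rewrite normr0 !mulr_ge0// ltW.
    rewrite /st -(subrKA (H k (c k))) QD (le_trans (ler_normD _ _))//.
    have h1 := HQ k _ _ km (cx M k WM (ltnW km)) (cc k).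
    have h2 := jQ k km; have h3 := WM k (ltnW km).
    rewrite [X in e * `|X|]addrAC subrr add0r in h1.
    have h4 : e * `|x M k| <= e * (2 * rho k.+1).
      by rewrite ler_pM2l// (le_trans h3).
    have -> : 3 * e * rho k.+1 = e * (2 * rho k.+1) + e * rho k.+1 by ring.
    by rewrite lerD// (le_trans h1).
  have u1 : `|un M k| <= 4 * e * rho k.
    rewrite /un; case: ltnP => [{}km|_]; last by rewrite normr0 !mulr_ge0// ltW.
    rewrite (vec1 _ (H k (c k))) (linearB (g k)) (linearB (g k)) vec2.
    have h1 := HP k _ _ km (cx M k WM (ltnW km)) (cc k).
    rewrite [c k + _ - _]addrAC subrr add0r in h1.
    have h2 := jP k km.
    have h3 := gK k (x M k.+1) km.
    have h4 : e * `|x M k| <= e * rho k by rewrite ler_pM2l// WM// ltnW.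
    have h5 : e * `|x M k.+1| <= e * (2 * rho k).
      by rewrite ler_pM2l// (le_trans (WM _ km)).
    have -> : 4 * e * rho k = e * rho k + (e * (2 * rho k) + e * rho k) by ring.
    rewrite (le_trans (ler_normD _ _))// lerD// ?(le_trans h1)//.
    by rewrite (le_trans (ler_normB _ _))// lerD// (le_trans h3).
  have : e * 8 * rho k <= rho k by rewrite ler_piMl.
  have := mulr_ge0 (ltW e0) (rho0 k); lra.
have Tlip M M' : W M -> W M' -> `|T M - T M'| <= 2^-1 * `|M - M'|.
  move=> WM WM'.
  have xle k : `|x M k - x M' k| <= `|M - M'|.
    apply: norm_le_coord => // i j; rewrite /x !mxE.
    by have := coord_le_norm (M - M') (inord k) j; rewrite !mxE.
  apply: norm_le_coord; first by rewrite mulr_ge0.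
  move=> i j; have im : (i <= m)%N by rewrite -ltnS.
  have -> : (T M - T M') i j =
      ((st M i - st M' i) + (un M i - un M' i)) 0 j.
    by rewrite !mxE addrACA opprD.
  apply: (le_trans (coord_le_norm _ _ _)); rewrite (le_trans (ler_normD _ _))//.
  have s1 : `|st M i - st M' i| <= e * `|M - M'|.
    case: (i : nat) im => [|k] km; first by rewrite subrr normr0 mulr_ge0// ltW.
    rewrite /st -QB opprB addrA subrK.
    rewrite (le_trans (HQ k _ _ km (cx M k WM (ltnW km)) (cx M' k WM' (ltnW km))))//.
    by rewrite ler_pM2l// opprD addrACA subrr add0r.
  have u1 k : `|un M k - un M' k| <= 2 * e * `|M - M'|.
    rewrite /un; case: ltnP => [km|_]; last first.
      by rewrite subrr normr0 !mulr_ge0// ltW.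
    have -> : P k (x M k) + g k (c k.+1 + x M k.+1 - H k (c k + x M k)) -
        (P k (x M' k) + g k (c k.+1 + x M' k.+1 - H k (c k + x M' k))) =
        (P k (c k + x M k - (c k + x M' k)) -
           g k (H k (c k + x M k) - H k (c k + x M' k))) +
        g k (x M k.+1 - x M' k.+1).
      rewrite opprD addrACA -(linearB (P k)) -(linearB (g k)).
      rewrite -[RHS]addrA [- g k _ + _]addrC -(linearB (g k)); congr (P k _ + g k _).
        by rewrite opprD addrACA subrr add0r.
      by rewrite vec3 opprD addrACA subrr add0r.
    have h1 := HP k _ _ km (cx M k WM (ltnW km)) (cx M' k WM' (ltnW km)).
    have h2 := gK k (x M k.+1 - x M' k.+1) km.
    rewrite -mulrA mulr2n mulrDl !mul1r (le_trans (ler_normD _ _))//.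
    rewrite lerD// ?(le_trans h1)// ?(le_trans h2)// ler_pM2l//.
    by rewrite opprD addrACA subrr add0r.
  have : e * 8 * `|M - M'| <= `|M - M'| by rewrite ler_piMl.
  have := u1 i; have := mulr_ge0 (ltW e0) (normr_ge0 (M - M')); lra.
have cW : closed W.
  have -> : W = \bigcap_(k in [set k | (k <= m)%N]) \bigcap_(j in [set: 'I_n])
      (fun M : 'M[R]_(m.+1, n) => `|M (inord k) j|) @^-1` [set r | r <= rho k].
    apply/seteqP; split => [M WM k /= km j _ /=|M WM k km].
      by have := coord_le_norm (x M k) 0 j; rewrite mxE => /le_trans; apply; exact: WM.
    by apply: norm_le_coord => // i j; rewrite mxE; exact: WM.
  apply: closed_bigI => k _; apply: closed_bigI => j _.
  apply: closed_comp => [M _|]; last exact: closed_le.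
  apply: continuous_comp; first exact: coord_continuous.
  exact: norm_continuous.
pose F := mkfun_fun TW.
have Fc : is_contraction F.
  exists (2^-1)%:nng; split => /=; first by rewrite invf_lt1// ltr1n.
  by move=> [M M'] /= [WM WM']; exact: Tlip.
have W0 : W !=set0.
  by exists 0 => k km; rewrite /x row0 normr0.
have [M WM ME] := banach_fixed_point Fc cW W0.
have {}ME : M = T M by [].
exists (fun k => c k + x M k); split => [k km|k km]; first exact: cx.
have xE k' : (k' <= m)%N -> x M k' = st M k' + un M k'.
  by move=> ?; rewrite {1}ME xT.
have PS k' : (k' <= m)%N -> P k' (st M k') = 0.
  by case: k' => [|k'] k'm; [rewrite linear0|exact: PQ].
have stQ : Q k.+1 (st M k.+1) = st M k.+1 by rewrite /Q PS// subr0.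
have Pun k' : P k' (un M k') = un M k'.
  rewrite /un; case: ltnP => [k'm|_]; last by rewrite linear0.
  by rewrite linearD/= PP ?Pg// ltnW.
have gz : P k.+1 (c k.+1 + x M k.+1 - H k (c k + x M k)) = 0.
  apply: (ginj k _ km).
  have := congr1 (P k) (xE k (ltnW km)).
  rewrite linearD/= PS ?(ltnW km)// add0r Pun /un km => /eqP.
  by rewrite addrC -subr_eq subrr eq_sym => /eqP.
apply/eqP; rewrite -subr_eq0; apply/eqP.
rewrite -[LHS](subrK (P k.+1 (c k.+1 + x M k.+1 - H k (c k + x M k)))).
rewrite {2}gz addr0 -/(Q k.+1 _) addrAC -[c k.+1 - _]opprB addrC QB {1}xE//.
rewrite QD stQ /Q Pun subrr addr0 /=.
by rewrite /Q subrr.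
Qed.
End Shadowing.

(** * Compactness and finite atlases *)

Section UniformCompact.
Context {R : realType} {M : topologicalType}.

(** All the uniform constants on [M] come from this principle. The indices are
    the charts of a finite atlas, or pairs of them. *)
Lemma compact_uniform (I : finType) (P : R -> I -> M -> Prop) :
  compact [set: M] ->
  (forall r r' i x, r' <= r -> P r i x -> P r' i x) ->
  (forall i (x0 : M), exists2 r, 0 < r & \forall x \near x0, P r i x) ->
  exists2 r, 0 < r & forall i x, P r i x.
Proof.
move=> /compact_near_coveringP cM Pmono Ploc.
have := cM R (0%R : R)^'+ (fun r x => forall i, P r i x) _ _; case.
  move=> x0 _.
  have Pi (i : I) : \forall x \near x0 & r \near (0 : R)^'+, P r i x.
    have [r r0 Pr] := Ploc i x0.
    exists ([set x | P r i x], [set s | s <= r]) => /=.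
      by split => //; apply: nbhs_right_le.
    by case=> x s /= [Px sr]; exact: Pmono Px.
  exact: (@filter_forall _ _ (fun i (p : M * R) => P p.2 i p.1)
    (filter_prod (nbhs x0) (0 : R)^'+) _ Pi).
move=> r /= r0 Pr.
exists (r / 2); first by rewrite divr_gt0.
move=> i x; apply: (Pr (r / 2)) => //=; last by rewrite divr_gt0.
by rewrite sub0r normrN gtr0_norm ?divr_gt0// ltr_pdivrMr// ltr_pMr// ltr1n.
Qed.
End UniformCompact.

Section FiniteAtlas.
Context {R : realType} {n : nat} {M : topologicalType} (X : manifold R n M).

Lemma nbhs_chart_img (i : chart_index X) u :
  chart_img i u -> \forall v \near u, chart_img i v.
Proof. by have := @chart_img_open _ _ _ X i; rewrite openE; apply. Qed.

Lemma nbhs_chart_dom (i : chart_index X) x :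
  chart_dom i x -> \forall y \near x, chart_dom i y.
Proof. by have := @chart_dom_open _ _ _ X i; rewrite openE; apply. Qed.

Lemma open_chart_preimage (i : chart_index X) (W : set M) :
  open W -> open (chart_img i `&` chart_inv i @^-1` W).
Proof.
move=> oW; rewrite openE => u [iu Wu].
apply: filterI; first exact: nbhs_chart_img.
apply: (chart_inv_continuous iu); exact: open_nbhs_nbhs.
Qed.

(** Balls of radius [fa_radius] already cover [M]. The larger concentric balls,
    up to four times the radius, leave room for points near a point of the
    small ball, for their neighbours, and for a margin in which the estimates
    hold, without changing chart. *)
Record finite_atlas := FiniteAtlas {
  fa_size : nat ;
  fa_chart : 'I_fa_size -> chart_index X ;
  fa_center : 'I_fa_size -> 'rV[R]_n ;
  fa_radius : 'I_fa_size -> R ;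
  fa_radius_gt0 : forall t, 0 < fa_radius t ;
  fa_img : forall t u, `|u - fa_center t| <= 4 * fa_radius t ->
    chart_img (fa_chart t) u ;
  fa_cover : forall x, exists t, chart_dom (fa_chart t) x /\
    `|chart (fa_chart t) x - fa_center t| < fa_radius t
}.

(** Each point has a chart around it that contains a ball of radius [4 * r].
    Finitely many of them are extracted by covering compactness for the filter
    of the finite lists of points that contain a large enough one. *)
Lemma finite_atlas_exists : compact [set: M] -> inhabited finite_atlas.
Proof.
move=> /compact_near_coveringP cM.
have rP x : {r : R | 0 < r & forall u, `|u - chart (chart_at X x) x| <= 4 * r ->
    chart_img (chart_at X x) u}.
  apply/cid2.
  have := nbhs_chart_img (chart_in_img (mem_chart_at X x)).
  move=> /nbhs_closedballP[r Hr].
  exists (r%:num / 4) => // u; rewrite mulrC divfK// => ur; apply: Hr.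
  rewrite /= closed_ballE//.
  by have : `|chart (chart_at X x) x - u| <= r%:num by rewrite distrC.
pose rad x := s2val (rP x).
have rad0 x : 0 < rad x by exact: (s2valP (rP x)).
pose U x : set M := [set y | chart_dom (chart_at X x) y /\
   `|chart (chart_at X x) y - chart (chart_at X x) x| < rad x].
have Unear (x : M) : \forall y \near x, U x y.
  apply: filterI.
    exact: nbhs_chart_dom (mem_chart_at X x).
  have := chart_continuous (mem_chart_at X x).
  move=> /cvgr_dist_lt /(_ _ (rad0 x)); apply: filterS => y.
  by rewrite distrC.
pose F : set_system (seq M) :=
  [set A : set (seq M) | exists s : seq M, forall s' : seq M, {subset s <= s'} -> A s'].
have FF : Filter F.
  split; first by exists [::].
    move=> A B [s sA] [s' sB]; exists (s ++ s') => s1 ss1.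
    by split; [apply: sA|apply: sB] => x xs; apply: ss1; rewrite mem_cat xs ?orbT.
  by move=> A B AB [s sA]; exists s => s' /sA/AB.
have [|s0 Hs0] := cM _ F (fun (s : seq M) x => exists2 c, c \in s & U c x) FF.
  move=> x _; exists (U x, [set s : seq M | x \in s]) => /=.
    split; first exact: Unear.
    by exists [:: x] => s' /(_ x); apply; rewrite inE.
  by case=> y s /= [Uy xs]; exists x.
have {}Hs0 := Hs0 s0 (fun=> id).
pose cc (t : 'I_(size s0)) := tnth (in_tuple s0) t.
constructor.
apply: (@FiniteAtlas (size s0) (fun t => chart_at X (cc t))
  (fun t => chart (chart_at X (cc t)) (cc t)) (fun t => rad (cc t))) => //.
- by move=> t u; exact: (s2valP' (rP (cc t))).
- move=> x; have [c /(tnthP (in_tuple s0)) [t ->] Ux] := Hs0 x I.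
  by exists t.
Qed.

End FiniteAtlas.

(** * Continuously differentiable maps read in charts *)

Section C1Maps.
Context {R : realType} {n : nat}.

Lemma strictly_differentiable_near (m : nat) (H H' : 'rV[R]_n -> 'rV[R]_m)
    (u : 'rV[R]_n) :
  (\forall v \near u, H v = H' v) -> strictly_differentiable H u ->
  strictly_differentiable H' u /\ 'd H' u = 'd H u :> (_ -> _).
Proof.
move=> /nbhs_closedballP[s Hs] [_ Hu].
apply: strictly_differentiable_of_linear => e e0.
have [r r0 Hr] := Hu e e0.
exists (Num.min r s%:num); first by rewrite lt_min r0 /=.
have eqH v : `|v - u| <= Num.min r s%:num -> H v = H' v.
  rewrite le_min => /andP[_ vs]; apply: Hs; rewrite /= closed_ballE//.
  by have : `|u - v| <= s%:num by rewrite distrC.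
move=> v v' vr v'r; rewrite -(eqH v)// -(eqH v')//.
by apply: Hr; [move: vr|move: v'r]; rewrite le_min => /andP[].
Qed.

(** If the increments of [H] on a ball are approximated by [B] up to [e], so is
    its differential at an interior point: it is the limit of the increments. *)
Lemma diff_close (m : nat) (H : 'rV[R]_n -> 'rV[R]_m) (u u0 : 'rV[R]_n)
    (B : {linear 'rV[R]_n -> 'rV[R]_m}) (r e : R) :
  strictly_differentiable H u -> `|u - u0| < r ->
  (forall v v', `|v - u0| <= r -> `|v' - u0| <= r ->
     `|H v - H v' - B (v - v')| <= e * `|v - v'|) ->
  forall w, `|'d H u w - B w| <= e * `|w|.
Proof.
move=> [_ Hu] ur Hr w; apply/ler_addgt0Pr => d d0.
have w1 : 0 < `|w| + 1 by rewrite ltr_wpDl.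
have [s s0 Hs] := Hu (d / (`|w| + 1)) (divr_gt0 d0 w1).
pose h := Num.min s (r - `|u - u0|) / (`|w| + 1).
have m0 : 0 < Num.min s (r - `|u - u0|) by rewrite lt_min s0 subr_gt0.
have h0 : 0 < h by rewrite divr_gt0.
have hw : h * `|w| <= Num.min s (r - `|u - u0|).
  by rewrite /h mulrAC ler_pdivrMr// ler_pM2l// lerDl.
have [hs hr] : h * `|w| <= s /\ h * `|w| <= r - `|u - u0|.
  by move: hw; rewrite le_min => /andP.
have h1 := Hs (h *: w + u) u; have h2 := Hr (h *: w + u) u.
rewrite addrK normrZ (gtr0_norm h0) subrr normr0 in h1.
rewrite addrK normrZ (gtr0_norm h0) in h2.
have {}h1 := h1 hs (ltW s0); have {}h2 := h2 _ (ltW ur).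
have {}h2 : `|H (h *: w + u) - H u - B (h *: w)| <= e * (h * `|w|).
  apply: h2; rewrite -addrA (le_trans (ler_normD _ _))// normrZ (gtr0_norm h0).
  by rewrite -lerBrDr.
rewrite -(ler_pM2l h0) -[X in X * `|_|](gtr0_norm h0) -normrZ scalerBr -!linearZ/=.
set D := H (h *: w + u) - H u in h1 h2.
have -> : 'd H u (h *: w) - B (h *: w) = (D - B (h *: w)) - (D - 'd H u (h *: w)).
  by rewrite opprB [RHS]addrC subrKA.
rewrite (le_trans (ler_normB _ _))// mulrDr lerD//.
  by rewrite mulrCA.
apply: (le_trans h1); rewrite mulrCA ler_pM2l//.
by rewrite mulrAC ler_pdivrMr// ler_pM2l// lerDl.
Qed.

Lemma norm_sub_continuous (c : 'rV[R]_n) : continuous (fun u => `|u - c|).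
Proof.
move=> u; apply: (@continuous_comp _ _ _ (fun u => u - c) (@Num.norm R _)).
  by apply: (@continuousB R _ _ id (cst c)); [exact: cvg_id|exact: cst_continuous].
exact: norm_continuous.
Qed.

Context {M : topologicalType} (X : manifold R n M).
Implicit Types (i j k : chart_index X) (F G : M -> M) (x : M).

(** The point where [local_map] is differentiated in [local_diff] is given on
    the manifold, so that differentials compose without transport from one
    expression of that point to another. *)
Definition local_map i j F : 'rV[R]_n -> 'rV[R]_n :=
  chart j \o F \o chart_inv i.

Definition local_diff i j F x : {linear 'rV[R]_n -> 'rV[R]_n} :=
  'd (local_map i j F) (chart i x).

Definition C1_map F : Prop := continuous F /\
  forall i j x, chart_dom i x -> chart_dom j (F x) ->
    strictly_differentiable (local_map i j F) (chart i x).

Lemma nbhs_chart_pullback i x (P : M -> Prop) : chart_dom i x ->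
  (\forall y \near x, P y) -> \forall v \near chart i x, P (chart_inv i v).
Proof.
move=> ix Px; have := chart_inv_continuous (chart_in_img ix).
by rewrite /prop_for /continuous_at chartK// => /(_ _ Px).
Qed.

Lemma C1_map_id : C1_map id.
Proof.
split=> [x|i j x ix jx]; first exact: cvg_id.
have h := @chart_smooth _ _ _ X i j 1%N.
apply: (Ck1_strictly_differentiable _ h).
  exact/open_chart_preimage/chart_dom_open.
by split; [exact: chart_in_img|rewrite /= chartK].
Qed.

Lemma local_comp i j k F G x : C1_map F -> C1_map G ->
  chart_dom i x -> chart_dom j (F x) -> chart_dom k (G (F x)) ->
  strictly_differentiable (local_map i k (G \o F)) (chart i x) /\
  local_diff i k (G \o F) x = local_diff j k G (F x) \o local_diff i j F x
    :> (_ -> _).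
Proof.
move=> [cF HF] [cG HG] ix jx kx.
have uE : local_map i j F (chart i x) = chart j (F x).
  by rewrite /local_map /= chartK.
have sF := HF i j x ix jx; have := HG j k (F x) jx kx; rewrite -uE => sG.
have [||s d] := @strictly_differentiable_near _ (local_map j k G \o local_map i j F)
    (local_map i k (G \o F)) (chart i x).
- apply: (@nbhs_chart_pullback i x (fun y => chart k (G (chart_inv j (chart j (F y))))
    = chart k (G (F y)))) => //.
  have : \forall y \near x, chart_dom j (F y).
    exact: (cF x) (nbhs_chart_dom jx).
  by apply: filterS => y jy; rewrite chartK.
- exact: strictly_differentiable_comp.
split; first exact: s.
apply: (etrans d); rewrite /local_diff -uE.
exact: (diff_comp (proj1 sF) (proj1 sG)).
Qed.

Lemma C1_map_comp F G : C1_map F -> C1_map G -> C1_map (G \o F).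
Proof.
move=> CF CG; split=> [x|i j x ix jx].
  by apply: continuous_comp; [exact: CF.1|exact: CG.1].
by have [] := local_comp CF CG ix (mem_chart_at X (F x)) jx.
Qed.

Lemma C1_map_iter F m : C1_map F -> C1_map (iter m F).
Proof.
move=> CF; elim: m => [|m IH]; first exact: C1_map_id.
exact: C1_map_comp IH CF.
Qed.

Lemma local_diffeo_C1 F : local_diffeo X F -> C1_map F.
Proof.
move=> lF; have cF : continuous F.
  by move=> x; have [U [_ Ux _ [cU _] _]] := lF x; exact: cU.
split=> // i j x ix jx; have [U [oU Ux _ [_ CU] _]] := lF x.
apply: (Ck1_strictly_differentiable _ (CU i j)).
  apply: open_chart_preimage; apply: openI => //.
  by apply: open_comp => [y _|]; [exact: cF|exact: chart_dom_open].
by split; [exact: chart_in_img|rewrite /= chartK].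
Qed.

Lemma local_diffeo_nbhs_image F x (P : set M) : local_diffeo X F ->
  (\forall y \near x, P y) -> \forall y \near F x, (F @` P) y.
Proof.
move=> lF Px; have [U [oU Ux oFU _ [h [hK [ch _]]]]] := lF x.
have Fx : (F @` U) (F x) by exists x.
have := ch _ Fx; rewrite /prop_for /continuous_at hK// => /(_ _ Px) hP.
have FU : nbhs (F x) (F @` U) by exact: open_nbhs_nbhs.
have {}hP : nbhs (F x) (h @^-1` P) by [].
apply: filterS (filterI hP FU) => y [/= Phy [w Uw wy]].
by exists w => //; rewrite -(hK w Uw) wy.
Qed.

End C1Maps.

(** * Uniform estimates over a finite atlas *)

Section UniformEstimates.
Context {R : realType} {n : nat} {M : topologicalType} (X : manifold R n M)
  (A : finite_atlas X).
Implicit Types (t : 'I_(fa_size A)) (F : M -> M) (x : M) (a : R).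
Hypothesis M_compact : compact [set: M].
Local Notation ci := (@fa_chart _ _ _ _ A).
Local Notation phi t := (chart (ci t)).
Local Notation psi t := (chart_inv (ci t)).

(** The closed chart ball of radius [a] times [fa_radius t]. The factor 1 gives
    a cover, and by [core_nbhs] a larger factor absorbs small displacements:
    factor 2 for points close to a chosen one, factor 3 for points close to
    those. *)
Definition core a t : set M := [set x | chart_dom (ci t) x /\
  `|phi t x - fa_center t| <= a * fa_radius t].

Lemma core_le a b t x : a <= b -> core a t x -> core b t x.
Proof.
by move=> ab [tx xa]; split => //; rewrite (le_trans xa)// ler_pM2r// fa_radius_gt0.
Qed.

Lemma core_chart_inv a t u : a <= 4 -> `|u - fa_center t| <= a * fa_radius t ->
  core a t (psi t u) /\ phi t (psi t u) = u.
Proof.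
move=> a4 ua; have iu : chart_img (ci t) u.
  by apply: fa_img; rewrite (le_trans ua)// ler_pM2r// fa_radius_gt0.
by split; [split; [exact: chart_inv_in_dom|rewrite chart_invK]|rewrite chart_invK].
Qed.

(** The ball is compact in [R^n] because the chart extends beyond it, and its
    image is compact, hence closed, in the Hausdorff space [M]. *)
Lemma closed_in_core a t (C : set 'rV[R]_n) : a <= 4 -> closed C ->
  closed [set x | core a t x /\ C (phi t x)].
Proof.
move=> a4 cC.
pose K := [set u : 'rV[R]_n | `|u - fa_center t| <= a * fa_radius t].
have -> : [set x | core a t x /\ C (phi t x)] = psi t @` (K `&` C).
  apply/seteqP; split => [x [[tx xa] Cx]|_ [u [Ku Cu] <-]].
    by exists (phi t x) => //; rewrite chartK.
  by have [Ku1 Ku2] := core_chart_inv a4 Ku; split=> //; rewrite Ku2.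
apply: compact_closed; first exact: (manifold_hausdorff X).
apply: continuous_compact.
  apply: continuous_in_subspaceT => u; rewrite inE => -[Ku _].
  apply: chart_inv_continuous; apply: fa_img.
  by rewrite (le_trans Ku)// ler_pM2r// fa_radius_gt0.
apply: bounded_closed_compact.
  exists (a * fa_radius t + `|fa_center t|); split; first exact: num_real.
  move=> b /ltW ab u [Ku _]; apply: le_trans ab.
  rewrite -(subrK (fa_center t) u) (le_trans (ler_normD _ _))//.
  by rewrite lerD2r.
apply: closedI => //.
apply: (@closed_comp _ _ (fun u : 'rV[R]_n => `|u - fa_center t|)
  [set r | r <= a * fa_radius t]); last exact: closed_le.
by move=> u _; exact: norm_sub_continuous.
Qed.

Lemma core_closed a t : a <= 4 -> closed (core a t).
Proof.
move=> a4; have := closed_in_core (t := t) a4 (@closedT 'rV[R]_n).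
by congr closed; apply/seteqP; split => x // -[].
Qed.

(** A local property that is required on the closed set [core a t] only is
    trivial near the points outside, which reduces it to the points inside. *)
Lemma core_cases a t x : a <= 4 ->
  core a t x \/ \forall y \near x, ~ core a t y.
Proof.
move=> a4; have [tx|ntx] := pselect (core a t x); [by left|right].
have : open (~` core a t) by exact/closed_openC/core_closed.
by rewrite openE; apply.
Qed.

Lemma core_nbhs a b t x : a < b -> core a t x -> \forall y \near x, core b t y.
Proof.
move=> ab [tx xa]; apply: filterI; first exact: nbhs_chart_dom.
have e0 : 0 < (b - a) * fa_radius t by rewrite mulr_gt0 ?subr_gt0// fa_radius_gt0.
have := chart_continuous tx; move=> /cvgr_dist_le /(_ _ e0).
apply: filterS => y xy; rewrite /= -(subrKA (phi t x)) (le_trans (ler_normD _ _))//.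
by rewrite -[leRHS](subrK (a * fa_radius t)) lerD// distrC -mulrBl.
Qed.

Lemma core_cover x : exists t, core 1 t x.
Proof.
have [t [tx xr]] := fa_cover A x; exists t; split => //.
by rewrite mul1r ltW.
Qed.

(** Strict differentiability at [x0] with constant [e / 2] on a ball gives the
    same approximation for all base points [x] near [x0], because the
    differentials at [x] and [x0] differ by at most [e / 2] ([diff_close]).
    Compactness makes the radius uniform. *)
Lemma uniformly_C1 F (e : R) : C1_map X F -> 0 < e -> exists2 r, 0 < r &
  forall t t' x, core 3 t x -> core 2 t' (F x) ->
    (forall v, `|v - phi t x| <= r ->
       chart_img (ci t) v /\ core 3 t' (F (psi t v))) /\
    (forall v v', `|v - phi t x| <= r -> `|v' - phi t x| <= r ->
       `|local_map (ci t) (ci t') F v - local_map (ci t) (ci t') F v' -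
           local_diff (ci t) (ci t') F x (v - v')| <= e * `|v - v'|).
Proof.
move=> CF e0.
pose P r (tt : 'I_(fa_size A) * 'I_(fa_size A)) x :=
  core 3 tt.1 x -> core 2 tt.2 (F x) ->
    (forall v, `|v - phi tt.1 x| <= r ->
       chart_img (ci tt.1) v /\ core 3 tt.2 (F (psi tt.1 v))) /\
    (forall v v', `|v - phi tt.1 x| <= r -> `|v' - phi tt.1 x| <= r ->
       `|local_map (ci tt.1) (ci tt.2) F v - local_map (ci tt.1) (ci tt.2) F v' -
           local_diff (ci tt.1) (ci tt.2) F x (v - v')| <= e * `|v - v'|).
have [|[t t'] x0|r r0 Pr] := compact_uniform (P := P) M_compact; last first.
- by exists r => // t t' x; exact: (Pr (t, t')).
- have le34 : 3 <= 4 :> R by rewrite ler_nat.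
  have le24 : 2 <= 4 :> R by rewrite ler_nat.
  have [cF sF] := CF.
  have [tx0|/= ntx] := core_cases t x0 le34; last first.
    by exists 1 => //; apply: filterS ntx => x nx /nx.
  have [tFx0|/= ntx] := core_cases t' (F x0) le24; last first.
    have {}ntx : \forall x \near x0, ~ core 2 t' (F x) by exact: (cF x0 _ ntx).
    by exists 1 => //; apply: filterS ntx => x nx _ /nx.
  have sx0 := sF _ _ _ tx0.1 tFx0.1.
  set H := local_map (ci t) (ci t') F in sx0.
  have [r1 r10 Hr1] := sx0.2 (e / 2) (divr_gt0 e0 (ltr0Sn _ _)).
  have : \forall v \near phi t x0, chart_img (ci t) v /\ core 3 t' (F (psi t v)).
    apply: filterI; first exact: nbhs_chart_img (chart_in_img tx0.1).
    apply: (nbhs_chart_pullback (P := fun y => core 3 t' (F y)) tx0.1).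
    by apply: (cF x0); apply: core_nbhs tFx0; rewrite ltr_nat.
  move=> /nbhs_closedballP[r2 Hr2].
  have {}Hr2 v : `|v - phi t x0| <= r2%:num ->
      chart_img (ci t) v /\ core 3 t' (F (psi t v)).
    move=> vr; apply: Hr2; rewrite /= closed_ballE//.
    by have : `|phi t x0 - v| <= r2%:num by rewrite distrC.
  pose q := Num.min r1 r2%:num.
  have q0 : 0 < q by rewrite lt_min r10 /=.
  have qq : q / 2 < q by rewrite ltr_pdivrMr// ltr_pMr// ltr1n.
  exists (q / 2); first by rewrite divr_gt0.
  have near_x0 : \forall x \near x0, `|phi t x - phi t x0| <= q / 2.
    have := chart_continuous tx0.1.
    move=> /cvgr_dist_le /(_ _ (divr_gt0 q0 (ltr0Sn _ 1))).
    by apply: filterS => x xq; rewrite distrC.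
  apply: filterS near_x0 => x xq tx tFx.
  have inq v : `|v - phi t x| <= q / 2 -> `|v - phi t x0| <= q.
    move=> vx; rewrite -(subrKA (phi t x)) (le_trans (ler_normD _ _))//.
    by rewrite (splitr q) lerD.
  have inr1 v : `|v - phi t x0| <= q -> `|v - phi t x0| <= r1.
    by move=> vq; rewrite (le_trans vq)// ge_min lexx.
  split=> [v vx|v v' vx v'x].
    by apply: Hr2; rewrite (le_trans (inq v vx))// ge_min lexx orbT.
  have dx : forall w, `|local_diff (ci t) (ci t') F x w -
      'd H (phi t x0) w| <= e / 2 * `|w|.
    apply: (@diff_close _ _ _ H (phi t x) (phi t x0) ('d H (phi t x0)) q).
    - exact: sF tx.1 tFx.1.
    - exact: le_lt_trans qq.
    - by move=> w w' wq w'q; apply: Hr1; exact: inr1.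
  set D := H v - H v'.
  have -> : D - local_diff (ci t) (ci t') F x (v - v') =
      (D - 'd H (phi t x0) (v - v')) -
      (local_diff (ci t) (ci t') F x (v - v') - 'd H (phi t x0) (v - v')).
    by rewrite opprB subrKA.
  rewrite (splitr e) mulrDl (le_trans (ler_normB _ _))// lerD//.
  by apply: Hr1; apply: inr1; exact: inq.
- move=> r r' [t t'] x r'r Pr tx tFx; have [P1 P2] := Pr tx tFx; split.
    by move=> v vr; apply: P1; exact: le_trans r'r.
  by move=> v v' vr v'r; apply: P2; exact: le_trans r'r.
Qed.

(** The bound is stated for [s = L^-1] in order to fit the monotonicity required
    by [compact_uniform]. Near [x0] the differential differs from the one at
    [x0] by at most 1. *)
Lemma uniformly_bounded_diff F : C1_map X F -> exists2 L : R, 0 < L &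
  forall t t' x, core 3 t x -> core 2 t' (F x) ->
    forall w, `|local_diff (ci t) (ci t') F x w| <= L * `|w|.
Proof.
move=> CF; have [r r0 Hr] := uniformly_C1 CF ltr01.
pose P s (tt : 'I_(fa_size A) * 'I_(fa_size A)) x :=
  core 3 tt.1 x -> core 2 tt.2 (F x) ->
    forall w, s * `|local_diff (ci tt.1) (ci tt.2) F x w| <= `|w|.
have [||s s0 Ps] := compact_uniform (P := P) M_compact; last first.
- exists s^-1; first by rewrite invr_gt0.
  move=> t t' x tx tFx w; rewrite ler_pdivlMl//.
  exact: (Ps (t, t')).
- have le34 : 3 <= 4 :> R by rewrite ler_nat.
  have le24 : 2 <= 4 :> R by rewrite ler_nat.
  have [cF sF] := CF.
  move=> [t t'] x0.
  have [tx0|/= ntx] := core_cases t x0 le34; last first.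
    by exists 1 => //; apply: filterS ntx => x nx /nx.
  have [tFx0|/= ntx] := core_cases t' (F x0) le24; last first.
    have {}ntx : \forall x \near x0, ~ core 2 t' (F x) by exact: (cF x0 _ ntx).
    by exists 1 => //; apply: filterS ntx => x nx _ /nx.
  have [k k0 Hk] := linear_bound (local_diff (ci t) (ci t') F x0).
  exists (1 + k)^-1; first by rewrite invr_gt0 addr_gt0.
  have := chart_continuous tx0.1.
  move=> /cvgr_dist_lt /(_ _ r0).
  have k1 : 0 < 1 + k by rewrite addr_gt0.
  apply: filterS => x xr tx tFx w; rewrite (ler_pdivrMl _ _ k1).
  rewrite -(subrK (local_diff (ci t) (ci t') F x0 w) (local_diff _ _ _ x w)).
  apply: (le_trans (ler_normD _ _)); rewrite mulrDl; apply: lerD; last exact: Hk.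
  apply: (@diff_close _ _ _ (local_map (ci t) (ci t') F) (phi t x) (phi t x0) _ r).
  - exact: sF tx.1 tFx.1.
  - by rewrite distrC.
  - exact: (Hr t t' x0 tx0 tFx0).2.
- move=> s s' [t t'] x s's Ps tx tFx w.
  by rewrite (le_trans _ (Ps tx tFx w))// ler_wpM2r.
Qed.

(** This replaces the Riemannian distance, to which it is compared at the end
    only. It is not transitive, but [uniformly_continuous_close] for the
    identity map moves it from one chart to another. *)
Definition chart_close (e : R) (x y : M) : Prop :=
  exists t, [/\ core 3 t x, core 3 t y & `|phi t x - phi t y| <= e].

Lemma chart_close_sym e x y : chart_close e x y -> chart_close e y x.
Proof. by move=> [t [tx ty xy]]; exists t; split => //; rewrite distrC. Qed.

Lemma chart_close_refl e x : 0 <= e -> chart_close e x x.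
Proof.
move=> e0; have [t tx] := core_cover x; exists t.
have tx3 : core 3 t x by apply: core_le tx; rewrite ler1n.
by split=> //; rewrite subrr normr0.
Qed.

Lemma chart_close_le e e' x y : e <= e' -> chart_close e x y -> chart_close e' x y.
Proof. by move=> ee [t [tx ty xy]]; exists t; split => //; rewrite (le_trans xy). Qed.

Lemma uniformly_continuous_close F (e : R) : C1_map X F -> 0 < e ->
  exists2 d, 0 < d & forall x y, chart_close d x y -> forall t, core 2 t (F x) ->
    core 3 t (F y) /\ `|phi t (F x) - phi t (F y)| <= e.
Proof.
move=> CF e0; have [r r0 Hr] := uniformly_C1 CF ltr01.
have [L L0 HL] := uniformly_bounded_diff CF.
have L1 : 0 < 1 + L by rewrite addr_gt0.
exists (Num.min r (e / (1 + L))); first by rewrite lt_min r0 divr_gt0.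
move=> x y [t [tx ty]]; rewrite le_min => /andP[xyr xye] t' tFx.
have [H1 H2] := Hr t t' x tx tFx.
have yr : `|phi t y - phi t x| <= r by rewrite distrC.
have [[txd _] [tyd _]] := (tx, ty).
have [_] := H1 _ yr; rewrite chartK// => tFy; split=> //.
have := H2 (phi t x) (phi t y); rewrite subrr normr0 => /(_ (ltW r0) yr).
rewrite /local_map /= (chartK txd) (chartK tyd) => h.
set D := phi t' (F x) - phi t' (F y) in h *.
rewrite -(subrK (local_diff (ci t) (ci t') F x (phi t x - phi t y)) D).
apply: (le_trans (ler_normD _ _)).
apply: (@le_trans _ _ ((1 + L) * `|phi t x - phi t y|)).
  by rewrite mulrDl; apply: lerD; [exact: h|exact: HL].
by rewrite mulrC -ler_pdivlMr.
Qed.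

Lemma nbhs_chart_close (z : M) (e : R) : 0 < e ->
  exists2 W : set M, nbhs z W & forall x y, W x -> W y -> chart_close e x y.
Proof.
move=> e0; have [t tz] := core_cover z.
exists [set x | core 3 t x /\ `|phi t z - phi t x| <= e / 2].
  apply: filterI; first by apply: core_nbhs tz; rewrite ltr1n.
  have := chart_continuous tz.1.
  by move=> /cvgr_dist_le /(_ _ (divr_gt0 e0 (ltr0Sn _ 1))).
move=> x y [tx xz] [ty yz]; exists t; split => //.
rewrite -(subrKA (phi t z)) (le_trans (ler_normD _ _))//.
by rewrite (splitr e) lerD// distrC.
Qed.

Lemma chart_close_in_nbhs (z : M) (O : set M) : nbhs z O ->
  exists2 e, 0 < e & \forall x \near z, forall y, chart_close e x y -> O y.
Proof.
move=> Oz.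
have le34 : 3 <= 4 :> R by rewrite ler_nat.
have Pt t : \forall x \near z & e \near (0 : R)^'+,
    core 3 t x -> forall y, core 3 t y -> `|phi t x - phi t y| <= e -> O y.
  have [tz|ntz] := core_cases t z le34; last first.
    exists ([set x | ~ core 3 t x], setT) => /=.
      by split=> //; exact: filterT.
    by case=> x s [/= nx _] /nx.
  have := nbhs_chart_pullback tz.1 Oz.
  move=> /nbhs_closedballP[r Hr].
  have r20 : 0 < r%:num / 2 by rewrite divr_gt0.
  exists ([set x | `|phi t z - phi t x| <= r%:num / 2], [set s | s <= r%:num / 2]).
    split; last exact: nbhs_right_le.
    by have := chart_continuous tz.1; move=> /cvgr_dist_le /(_ _ r20).
  case=> x s [/= xz sr] tx y ty xy.
  rewrite -(chartK ty.1); apply: Hr; rewrite /= closed_ballE//.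
  suff : `|phi t z - phi t y| <= r%:num by [].
  rewrite -(subrKA (phi t x)) (le_trans (ler_normD _ _))//.
  by rewrite (splitr r%:num) lerD// (le_trans xy).
have := @filter_forall _ _ _ (filter_prod (nbhs z) (0 : R)^'+) _ Pt.
move=> [[U V] /= [Uz V0] UV].
have [e [e0 Ve]] : exists e, 0 < e /\ V e.
  have : \forall e \near (0 : R)^'+, 0 < e /\ V e.
    by apply: filterI => //; exact: nbhs_right_gt.
  exact: filter_ex.
exists e => //; apply: filterS Uz => x Ux y [t [tx ty xy]].
exact: (UV (x, e) (conj Ux Ve) t tx y ty xy).
Qed.

Lemma chart_close_closed (G : M -> M) (e : R) (y : M) : continuous G ->
  closed [set x | chart_close e (G x) y].
Proof.
move=> cG.
have -> : [set x | chart_close e (G x) y] = G @^-1` (\bigcup_(t in [set t | core 3 t y])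
    [set x | core 3 t x /\ `|phi t x - phi t y| <= e]).
  apply/seteqP; split => [x [t [tx ty xy]]|x [t /= ty [tx xy]]].
    by exists t.
  by exists t.
apply: closed_comp => //.
apply: closed_bigcup => [|t _]; first exact: finite_finset.
apply: (closed_in_core (a := 3) (t := t) (C := [set u | `|u - phi t y| <= e]));
  first by rewrite ler_nat.
apply: (@closed_comp _ _ (fun u : 'rV[R]_n => `|u - phi t y|) [set r | r <= e]);
  last exact: closed_le.
by move=> u _; exact: norm_sub_continuous.
Qed.

End UniformEstimates.

(** * The Riemannian norm and the chart norms are equivalent *)

Section QuadraticForms.
Context {R : realType} {n : nat}.
Local Notation V := 'rV[R]_n.
Local Notation e_ := (fun a : 'I_n => delta_mx 0 a : V).

Definition is_form (b : V -> V -> R) : Prop :=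
  (forall u v, b u v = b v u) /\
  (forall a u v w, b (a *: u + v) w = a * b u w + b v w).

Lemma form_expand b u : is_form b ->
  b u u = \sum_i \sum_j (u 0 i * u 0 j) * b (e_ i) (e_ j).
Proof.
move=> [bs bl].
have b0 w : b 0 w = 0.
  by have := bl (-1) 0 0 w; rewrite scaler0 addr0 mulN1r addNr.
have bsum (I : Type) (s : seq I) (c : I -> R) (d : I -> V) w :
    b (\sum_(i <- s) c i *: d i) w = \sum_(i <- s) c i * b (d i) w.
  by elim: s => [|i s IH]; rewrite ?big_nil// !big_cons bl IH.
rewrite [X in b X _]row_sum_delta bsum; apply: eq_bigr => i _.
rewrite bs [X in b X _]row_sum_delta bsum mulr_sumr; apply: eq_bigr => j _.
by rewrite mulrA (bs (e_ i)).
Qed.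

(** Two forms are close when their finitely many coefficients are, which turns
    the smoothness of the metric, given one coefficient at a time, into a bound
    that is uniform in the vector. *)
Lemma form_close b b' d u : is_form b -> is_form b' ->
  (forall i j, `|b (e_ i) (e_ j) - b' (e_ i) (e_ j)| <= d) ->
  `|b u u - b' u u| <= (n * n)%:R * d * `|u| ^+ 2.
Proof.
move=> fb fb' bd; rewrite (form_expand u fb) (form_expand u fb').
rewrite -sumrB (le_trans (ler_norm_sum _ _ _))//.
apply: (@le_trans _ _ (\sum_(i < n) \sum_(j < n) d * `|u| ^+ 2)).
  apply: ler_sum => i _; rewrite -sumrB (le_trans (ler_norm_sum _ _ _))//.
  apply: ler_sum => j _; rewrite -mulrBr normrM mulrC; apply: ler_pM => //.
  by rewrite normrM expr2; apply: ler_pM => //; exact: coord_le_norm.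
by rewrite !sumr_const !card_ord -mulrnA -[leLHS]mulr_natl mulrA.
Qed.

Lemma form_upper b : is_form b -> exists2 K, 0 < K & forall u, b u u <= K * `|u| ^+ 2.
Proof.
move=> fb; pose d : R := \sum_i \sum_j `|b (e_ i) (e_ j)|.
have d0 : 0 <= d by apply: sumr_ge0 => i _; apply: sumr_ge0.
have f0 : is_form (fun _ _ => 0) by split=> // a u v w; rewrite mulr0 addr0.
exists ((n * n)%:R * d + 1); first by rewrite ltr_wpDl// mulr_ge0.
move=> u; have := @form_close b _ d u fb f0; rewrite subr0 => h.
rewrite (le_trans (ler_norm _))// (le_trans (h _))//.
  move=> i j; rewrite subr0 /d (bigD1 i)//= (bigD1 j)//= -addrA lerDl.
  by rewrite addr_ge0// ?sumr_ge0// => k _; rewrite sumr_ge0.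
by rewrite ler_wpM2r ?exprn_ge0// lerDl.
Qed.

(** On the compact unit sphere the form has a positive minimum, and it is
    homogeneous of degree 2. *)
Lemma form_lower b : is_form b -> (forall u, u != 0 -> 0 < b u u) ->
  exists2 c, 0 < c & forall u, c * `|u| ^+ 2 <= b u u.
Proof.
move=> fb bpos; pose S := [set u : V | `|u| = 1].
have bZ a u : b (a *: u) (a *: u) = a ^+ 2 * b u u.
  rewrite (form_expand _ fb) (form_expand u fb) mulr_sumr; apply: eq_bigr => i _.
  rewrite mulr_sumr; apply: eq_bigr => j _; rewrite !mxE; ring.
have b00 : b 0 0 = 0 by have := bZ 0 0; rewrite scale0r expr0n mul0r.
have [[u0 Su0]|S0] := pselect (S !=set0); last first.
  exists 1 => // u; have [->|u0] := eqVneq u 0.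
    by rewrite normr0 expr0n mulr0 b00.
  exfalso; apply: S0; exists (`|u|^-1 *: u).
  by rewrite /S /= normrZ normfV normr_id mulVf// normr_eq0.
have cS : compact S.
  apply: bounded_closed_compact.
    exists 1; split; first exact: num_real.
    by move=> r /ltW r1 u /= ->.
  rewrite (_ : S = (fun u : V => `|u|) @^-1` [set x : R | x = 1])//.
  apply: closed_comp => [u _|]; first exact: norm_continuous.
  exact: closed_eq.
have bc : {within S, continuous (fun u => b u u)}.
  apply: continuous_subspaceT.
  have -> : (fun u => b u u) = (fun u : V =>
      \sum_i \sum_j (u 0 i * u 0 j) * b (e_ i) (e_ j)).
    by apply/funext => u; exact: form_expand.
  apply: (continuous_big (U := R^o)) => [|i _]; first exact: add_continuous.
  apply: (continuous_big (U := R^o)) => [|j _]; first exact: add_continuous.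
  move=> u; apply: (@continuousM R V (fun u => u 0 i * u 0 j) (cst (b (e_ i) (e_ j))));
    last exact: cst_continuous.
  by apply: (@continuousM R V (fun u => u 0 i) (fun u => u 0 j));
    exact: coord_continuous.
have [w] := EVT_min_rV (ex_intro _ u0 Su0) cS bc.
rewrite inE => Sw wmin.
have w0 : w != 0 by rewrite -normr_eq0 Sw oner_neq0.
exists (b w w); first exact: bpos.
move=> u; have [->|u1] := eqVneq u 0.
  by rewrite normr0 expr0n mulr0 b00.
have nu : `|u| != 0 by rewrite normr_eq0.
have := wmin (`|u|^-1 *: u); rewrite inE => /(_ _).
rewrite bZ exprVn ler_pdivlMl ?exprn_gt0 ?normr_gt0// mulrC; apply.
by rewrite /S /= normrZ normfV normr_id mulVf.
Qed.

End QuadraticForms.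

Section RiemannianCharts.
Context {R : realType} {n : nat} {M : topologicalType} (X : manifold R n M)
  (g : riemannian X) (A : finite_atlas X).
Implicit Types (i j : chart_index X) (x : M) (t : 'I_(fa_size A)).
Hypothesis M_compact : compact [set: M].
Local Notation ci := (@fa_chart _ _ _ _ A).
Local Notation phi t := (chart (ci t)).
Local Notation psi t := (chart_inv (ci t)).

Lemma local_diff_id i x v : chart_dom i x -> local_diff i i id x v = v.
Proof.
move=> ix.
have idE (u : 'rV[R]_n) : strictly_differentiable id u /\ 'd id u = idfun :> (_ -> _).
  apply: (@strictly_differentiable_of_linear _ _ _ _ _ idfun) => e e0.
  by exists 1 => // w w' _ _; rewrite subrr normr0 mulr_ge0// ltW.
have [d1 d2] := idE (chart i x).
have [||_ E] := @strictly_differentiable_near _ _ _ id (local_map i i id) (chart i x).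
- apply: filterS (nbhs_chart_img (chart_in_img ix)) => w iw.
  by rewrite /local_map /= chart_invK.
- exact: d1.
by rewrite /local_diff E d2.
Qed.

Lemma local_diff_id_comp i j k x v : chart_dom i x -> chart_dom j x ->
  chart_dom k x ->
  local_diff j k id x (local_diff i j id x v) = local_diff i k id x v.
Proof.
move=> ix jx kx.
by have [_ /(congr1 (fun f => f v)) /esym] :=
  local_comp (C1_map_id X) (C1_map_id X) ix jx kx.
Qed.

Lemma dchart_inv_local i x : chart_dom i x ->
  dchart_inv i (chart i x) = local_diff i (chart_at X x) id x :> (_ -> _).
Proof. by move=> ix; rewrite /dchart_inv chartK. Qed.

Lemma dchartK i x v : chart_dom i x ->
  dchart_inv i (chart i x) (dchart i x v) = v.
Proof.
move=> ix; rewrite dchart_inv_local//.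
rewrite -[dchart i x v]/(local_diff (chart_at X x) i id x v).
by rewrite local_diff_id_comp ?local_diff_id//; exact: mem_chart_at.
Qed.

Lemma dchart_invK i x v : chart_dom i x ->
  dchart i x (dchart_inv i (chart i x) v) = v.
Proof.
move=> ix; rewrite dchart_inv_local//.
rewrite -[LHS]/(local_diff (chart_at X x) i id x (local_diff _ _ _ _ _)).
by rewrite local_diff_id_comp ?local_diff_id//; exact: mem_chart_at.
Qed.

Definition chart_form i (w u v : 'rV[R]_n) : R :=
  metric g (chart_inv i w) (dchart_inv i w u) (dchart_inv i w v).

Lemma chart_form_is_form i w : is_form (chart_form i w).
Proof.
rewrite /chart_form; split=> [u v|a u v z]; first exact: Defs.metric_sym.
by rewrite -metric_linear /dchart_inv linearP.
Qed.

Lemma chart_form_pos i x u : chart_dom i x -> u != 0 ->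
  0 < chart_form i (chart i x) u u.
Proof.
move=> ix u0; apply: metric_pos; apply: contraNneq u0 => du0.
by rewrite -(dchart_invK u ix) du0 /dchart linear0.
Qed.

Lemma tnorm_chart i x v : chart_dom i x ->
  tnorm g x v = Num.sqrt (chart_form i (chart i x) (dchart i x v) (dchart i x v)).
Proof. by move=> ix; rewrite /tnorm /chart_form dchartK// chartK. Qed.

Let perturbed_bounds (c K q F F0 : R) : c * q <= F0 -> F0 <= K * q ->
  `|F - F0| <= c / 2 * q -> c / 2 * q <= F /\ F <= (K + c / 2) * q.
Proof. by move=> h1 h2; rewrite ler_norml => /andP[h3 h4]; split; lra. Qed.

(** At one point the norms are equivalent by [form_lower] and [form_upper].
    [form_close] propagates the constants to a neighbourhood, and compactness
    makes them uniform. *)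
Lemma tnorm_bounds : exists2 c : R, 0 < c & forall t x, core 3 t x -> forall v,
  c * `|dchart (ci t) x v| <= tnorm g x v /\
  c * tnorm g x v <= `|dchart (ci t) x v|.
Proof.
pose P r t x := core 3 t x -> forall u,
  r * `|u| ^+ 2 <= chart_form (ci t) (phi t x) u u /\
  r * chart_form (ci t) (phi t x) u u <= `|u| ^+ 2.
have le34 : 3 <= 4 :> R by rewrite ler_nat.
have form_ge0 t x u : core 3 t x -> 0 <= chart_form (ci t) (phi t x) u u.
  move=> [tx _]; have [->|u0] := eqVneq u 0; last exact/ltW/chart_form_pos.
  have [_ /(_ (-1) 0 0 0)] := chart_form_is_form (ci t) (phi t x).
  by rewrite scaler0 addr0 mulN1r addNr => ->.
have [||r r0 Pr] := compact_uniform (P := P) M_compact.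
- move=> r r' t x r'r Pr tx u; have [P1 P2] := Pr tx u; split.
    by rewrite (le_trans _ P1)// ler_wpM2r// exprn_ge0.
  by rewrite (le_trans _ P2)// ler_wpM2r// form_ge0.
- move=> t x0.
  have [tx0|/= ntx] := core_cases t x0 le34; last first.
    by exists 1 => //; apply: filterS ntx => x nx /nx.
  have fb := chart_form_is_form (ci t) (phi t x0).
  have [K K0 HK] := form_upper fb.
  have [c c0 Hc] := form_lower fb (fun u => @chart_form_pos (ci t) x0 u tx0.1).
  pose N : R := (n * n)%:R; pose d := c / 2 / (N + 1).
  have N0 : 0 <= N by rewrite /N.
  have N1 : 0 < N + 1 by rewrite ltr_wpDl.
  have d0 : 0 < d by rewrite !divr_gt0.
  have Nd : N * d <= c / 2.
    by rewrite /d mulrC mulrAC ler_pdivrMr// ler_pM2l ?divr_gt0// lerDl.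
  have near0 : \forall x \near x0, forall ij : 'I_n * 'I_n,
     `|chart_form (ci t) (phi t x) (delta_mx 0 ij.1) (delta_mx 0 ij.2) -
       chart_form (ci t) (phi t x0) (delta_mx 0 ij.1) (delta_mx 0 ij.2)| <= d.
    apply: (@filter_forall _ _ (fun (ij : 'I_n * 'I_n) x =>
      `|chart_form (ci t) (phi t x) (delta_mx 0 ij.1) (delta_mx 0 ij.2) -
       chart_form (ci t) (phi t x0) (delta_mx 0 ij.1) (delta_mx 0 ij.2)| <= d)
       (nbhs x0)) => -[a b] /=.
    have [cE _] := @metric_smooth _ _ _ _ g (ci t) (delta_mx 0 a) (delta_mx 0 b) 0%N.
    have cx := cE _ (chart_in_img tx0.1).
    have cc := continuous_comp (chart_continuous tx0.1) cx.
    exact: (cvgr_distC_le _ _ cc).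
  exists (Num.min (c / 2) (K + c / 2)^-1).
    by rewrite lt_min invr_gt0 addr_gt0 ?divr_gt0.
  apply: filterS near0 => x nx tx u.
  have h : `|chart_form (ci t) (phi t x) u u - chart_form (ci t) (phi t x0) u u|
      <= c / 2 * `|u| ^+ 2.
    apply: (le_trans (form_close u (chart_form_is_form _ _) fb (d := d) _)).
      by move=> a b; exact: (nx (a, b)).
    by rewrite ler_wpM2r// exprn_ge0.
  have [h1 h2] := perturbed_bounds (Hc u) (HK u) h.
  split.
    apply: (le_trans _ h1); apply: ler_wpM2r; first by rewrite exprn_ge0.
    by rewrite ge_min lexx.
  apply: (@le_trans _ _ ((K + c / 2)^-1 * chart_form (ci t) (phi t x) u u)).
    by apply: ler_wpM2r; [exact: form_ge0|rewrite ge_min lexx orbT].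
  by rewrite ler_pdivrMl ?addr_gt0 ?divr_gt0.
exists (Num.sqrt r); first by rewrite sqrtr_gt0.
move=> t x tx v; have [P1 P2] := Pr t x tx (dchart (ci t) x v).
rewrite (tnorm_chart v tx.1); split.
  rewrite -[`|_|]ger0_norm// -sqrtr_sqr -sqrtrM ?(ltW r0)//.
  exact: ler_wsqrtr.
rewrite -sqrtrM ?(ltW r0)// -[leRHS]ger0_norm// -sqrtr_sqr.
exact: ler_wsqrtr.
Qed.

End RiemannianCharts.

(** * The Riemannian distance of points that are close in a chart *)

Section DistanceBound.
Context {R : realType} {n : nat} {M : topologicalType} (X : manifold R n M)
  (g : riemannian X) (A : finite_atlas X).
Implicit Types (i j : chart_index X) (x y : M) (t : 'I_(fa_size A)).
Hypothesis M_compact : compact [set: M].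
Local Notation ci := (@fa_chart _ _ _ _ A).
Local Notation phi t := (chart (ci t)).
Local Notation psi t := (chart_inv (ci t)).

(** The integral of a nonnegative function, measurable or not, is a supremum
    over the simple functions below it, hence it is monotone. *)
Lemma Rintegral_bound (h : R -> R) (K : R) : 0 <= K ->
  (forall s, 0 <= h s) -> (forall s, 0 <= s <= 1 -> h s <= K) ->
  0 <= \int[lebesgue_measure]_(s in `[0, 1]) h s <= K.
Proof.
move=> K0 h0 hK; rewrite /Rintegral.
have mK : (\int[lebesgue_measure]_(s in `[0%R, 1%R]) K%:E = K%:E :> \bar R)%E.
  rewrite (@integral_cst _ _ _ lebesgue_measure `[0, 1]%classic) //.
  have l1 : (@lebesgue_measure R) `[0%R, 1%R]%classic = 1%E.
    by rewrite lebesgue_measure_itv/= lte_fin ltr01 oppr0 adde0.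
  by rewrite [X in (_ * X)%E]l1 mule1.
have i0 : (0 <= \int[lebesgue_measure]_(s in `[0%R, 1%R]) (h s)%:E :> \bar R)%E.
  by apply: integral_ge0 => s _; rewrite lee_fin.
have iK : (\int[lebesgue_measure]_(s in `[0%R, 1%R]) (h s)%:E <= K%:E :> \bar R)%E.
  rewrite -mK !ge0_integralE; [|by move=> s _; rewrite lee_fin..].
  apply: ereal_sup_le => _ [f fh <-]; exists f => // s.
  apply: (le_trans (fh s)); rewrite /patch; case: ifPn => //.
  by rewrite inE /= in_itv /= => /hK; rewrite lee_fin.
have [r rE] : exists r : R, (\int[lebesgue_measure]_(s in `[0%R, 1%R]) (h s)%:E = r%:E)%E.
  by move: i0 iK; case: (integral _ _ _) => // r; exists r.
by move: i0 iK; rewrite rE /= !lee_fin => -> ->.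
Qed.

(** A smooth map from the line to the unit interval that fixes 0 and 1. The curves
    that define the distance must be [C^1] on all of [R], so a straight segment
    in a chart cannot be parametrised affinely, as it would leave the chart. *)
Definition ease (s : R) : R := (1 - cos (pi * s)) / 2.

Lemma ease_derive (s : R) : is_derive s 1 ease (pi * sin (pi * s) / 2).
Proof.
have h : is_derive s (1 : R) (fun s : R => 1 - cos (pi * s)) (pi * sin (pi * s)).
  apply: is_derive_eq; rewrite [pi%:A]mulr1; ring.
by apply: is_derive_eq; rewrite !scaler0 add0r [LHS]mulrC.
Qed.

Lemma ease_itv s : 0 <= ease s <= 1.
Proof.
have := cos_max (pi * s); rewrite ler_norml /ease => /andP[h1 h2].
by rewrite divr_ge0 ?subr_ge0// ler_pdivrMr// mul1r lerBlDr; lra.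
Qed.

Lemma ease0 : ease 0 = 0.
Proof. by rewrite /ease mulr0 cos0 subrr mul0r. Qed.

Lemma ease1 : ease 1 = 1.
Proof. by rewrite /ease mulr1 cospi opprK divff. Qed.

Section Segment.
Variables (t : 'I_(fa_size A)) (p q : 'rV[R]_n).
Hypothesis p_core : `|p - fa_center t| <= 3 * fa_radius t.
Hypothesis q_core : `|q - fa_center t| <= 3 * fa_radius t.

Definition eased_line (s : R^o) : 'rV[R]_n := p + ease s *: (q - p).
Definition chart_segment (s : R) : M := psi t (eased_line s).
Let speed (s : R) : R := pi * sin (pi * s) / 2.

Lemma eased_line_core s : core (A := A) 3 t (chart_segment s) /\
  phi t (chart_segment s) = eased_line s.
Proof.
apply: core_chart_inv; first by rewrite ler_nat.
have /andP[e0 e1] := ease_itv s.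
have -> : eased_line s - fa_center t =
    (1 - ease s) *: (p - fa_center t) + ease s *: (q - fa_center t).
  apply/rowP => i; rewrite !mxE; ring.
rewrite (le_trans (ler_normD _ _))// (normrZ (1 - ease s)) (normrZ (ease s)).
have h1 : (1 - ease s) * `|p - fa_center t| <= (1 - ease s) * (3 * fa_radius t).
  by rewrite ler_wpM2l ?subr_ge0.
have h2 : ease s * `|q - fa_center t| <= ease s * (3 * fa_radius t).
  by rewrite ler_wpM2l.
rewrite (ger0_norm e0) ger0_norm ?subr_ge0// (le_trans (lerD h1 h2))//.
by rewrite -mulrDl subrK mul1r.
Qed.

Lemma eased_line_diff s : differentiable eased_line s /\
  forall v : R^o, 'd eased_line s v = (v * speed s) *: (q - p).
Proof.
have de : derivable ease s 1 by case: (ease_derive s).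
have dif : differentiable (ease : R^o -> R^o) s by apply/derivable1_diffP.
have dl : differentiable (fun s : R^o => ease s *: (q - p)) s.
  exact: differentiableZl.
split; first by apply: differentiableD.
move=> v.
have E1 : 'd eased_line s v = 'd (cst p : R^o -> 'rV[R]_n) s v +
    'd (fun s : R^o => ease s *: (q - p)) s v.
  exact: (congr1 (fun h => h v) (diffD (differentiable_cst p s) dl)).
have E2 : 'd (cst p : R^o -> 'rV[R]_n) s v = 0.
  exact: (congr1 (fun h => h v) (@diff_cst _ R^o _ p s)).
have E3 : 'd (fun s : R^o => ease s *: (q - p)) s v =
    'd (ease : R^o -> R^o) s v *: (q - p).
  exact: (congr1 (fun h => h v) (diffZl (q - p) dif)).
have E4 : 'd (ease : R^o -> R^o) s v = v * speed s.
  rewrite (congr1 (fun h => h v) (deriv1E de)) derive1E.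
  by case: (ease_derive s) => _ ->.
apply: (etrans E1); apply: (etrans (congr2 +%R E2 E3)).
by apply: (etrans (add0r _)); rewrite E4.
Qed.

Lemma eased_line_continuous : continuous eased_line.
Proof. by move=> s; apply: differentiable_continuous; case: (eased_line_diff s). Qed.

Lemma chart_segment_continuous : continuous chart_segment.
Proof.
move=> s; apply: continuous_comp; first exact: eased_line_continuous.
apply: chart_inv_continuous; have [[ts _] <-] := eased_line_core s.
exact: chart_in_img.
Qed.

(** In another chart [i] the curve is the image of the eased line by the change
    of charts, which is the local expression of the identity of [M]. *)
Lemma chart_segment_diff i s : chart_dom i (chart_segment s) ->
  forall v : R^o, derivable (chart i \o chart_segment : R^o -> 'rV[R]_n) s v /\
    'D_v (chart i \o chart_segment : R^o -> 'rV[R]_n) s =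
    (v * speed s) *: local_diff (ci t) i id (chart_segment s) (q - p).
Proof.
move=> is_; have [[ts _] lE] := eased_line_core s.
have [dH _] := (C1_map_id X).2 (ci t) i _ ts is_.
have [dl lv] := eased_line_diff s.
rewrite lE in dH.
have dc : differentiable (local_map (ci t) i id \o eased_line) s.
  exact: differentiable_comp.
move=> v; split; first exact: diff_derivable.
apply: (etrans (deriveE v dc)).
apply: (etrans (congr1 (fun h => h v) (diff_comp dl dH))).
apply: (etrans (congr1 ('d (local_map (ci t) i id) (eased_line s)) (lv v))).
rewrite -lE; exact: linearZ.
Qed.

Lemma chart_segment_C1 : C1_curve X chart_segment.
Proof.
split=> [|i]; first exact: chart_segment_continuous.
have near_dom s : chart_dom i (chart_segment s) ->
    \forall r \near (s : R^o), chart_dom i (chart_segment r).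
  by move=> is_; apply: chart_segment_continuous; exact: nbhs_chart_dom.
split=> [s is_|v].
  apply: continuous_comp; first exact: chart_segment_continuous.
  exact: chart_continuous.
split=> [s is_|]; first by have [] := chart_segment_diff is_ v.
split; last exact: I.
move=> s is_; have [[ts _] lE] := eased_line_core s.
pose D (r : R^o) : 'rV[R]_n := (v * speed r) *:
  'D_(q - p) (local_map (ci t) i id) (eased_line r).
(* The derivative is continuous because near s it coincides with the eased
   speed times a directional derivative of the smooth change of charts. *)
have DE : {near (s : R^o), D =1 'D_v (chart i \o chart_segment : R^o -> 'rV[R]_n)}.
  apply: filterS (near_dom s is_) => r ir.
  have [_ ->] := chart_segment_diff ir v; rewrite /D /local_diff.
  have [[tr _] lr] := eased_line_core r.
  have [dH _] := (C1_map_id X).2 (ci t) i _ tr ir.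
  by rewrite -lr (deriveE _ dH).
have Dc : {for (s : R^o), continuous D}.
  have [_ sm] := (@chart_smooth _ _ _ X (ci t) i 1%N).
  have [_ [smc _]] := sm (q - p).
  have sc : {for (s : R^o), continuous (fun r : R^o => v * speed r)}.
    apply: continuousM; first exact: cst_continuous.
    have c1 : {for (s : R^o), continuous (fun r : R^o => sin (pi * r) : R^o)}.
      apply: continuous_comp; last exact: continuous_sin.
      by apply: continuousM; [exact: cst_continuous|exact: cvg_id].
    apply: (@continuousM R R^o (fun r => pi * sin (pi * r)) (cst 2^-1)); last exact: cst_continuous.
    by apply: (@continuousM R R^o (cst pi) (fun r => sin (pi * r)));
      [exact: cst_continuous|exact: c1].
  apply: continuousZ; first exact: sc.
  have hU : (chart_img (ci t) `&` chart_inv (ci t) @^-1` chart_dom i) (eased_line s).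
    by split; [rewrite -lE; exact: chart_in_img|rewrite /= -lE chartK].
  exact: (continuous_comp (@eased_line_continuous s) (smc _ hU)).
have := Dc; rewrite /prop_for /continuous_at => Dc'.
apply: cvg_trans; first exact: (near_eq_cvg DE).
by rewrite -(nbhs_singleton DE).
Qed.

Lemma chart_segment_speed s :
  `|dchart (ci t) (chart_segment s) (velocity X chart_segment s)| <= pi * `|q - p|.
Proof.
have [[ts _] lE] := eased_line_core s.
have vE : velocity X chart_segment s = (1 * speed s) *:
    local_diff (ci t) (chart_at X (chart_segment s)) id (chart_segment s) (q - p).
  exact: (chart_segment_diff (mem_chart_at X (chart_segment s)) 1).2.
rewrite vE mul1r -[dchart _ _ _]/(local_diff (chart_at X (chart_segment s)) (ci t) id
  (chart_segment s) (speed s *: _)).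
rewrite linearZ/= local_diff_id_comp ?local_diff_id//; last exact: mem_chart_at.
rewrite normrZ ler_wpM2r// /speed normrM normfV [`|2|]gtr0_norm//.
rewrite ler_pdivrMr// normrM gtr0_norm ?pi_gt0// ler_wpM2l ?pi_ge0//.
by rewrite (le_trans (sin_max _))// ler1n.
Qed.

End Segment.

Lemma dist_ge0 x y : 0 <= dist g x y.
Proof.
rewrite /dist; set S := image _ _.
have [->|/set0P[r Sr]] := eqVneq S set0; first by rewrite inf0.
apply: lb_le_inf; first by exists r.
move=> _ [s _ <-]; apply: sumr_ge0 => c _.
rewrite /curve_length /Rintegral fine_ge0// integral_ge0// => u _.
by rewrite lee_fin /tnorm sqrtr_ge0.
Qed.

(** The segment in the chart has chart length at most [pi] times the norm of its
    increment, hence a comparable Riemannian length. *)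
Lemma dist_le_chart_close : exists2 D : R, 0 < D & forall e x y,
  chart_close A e x y -> dist g x y <= D * e.
Proof.
have [c c0 Hc] := tnorm_bounds g A M_compact.
exists (pi / c); first by rewrite divr_gt0 ?pi_gt0.
move=> e x y [t [[tx xc] [ty yc] xy]].
have lenE : 0 <= curve_length g (chart_segment t (phi t x) (phi t y))
    <= pi / c * `|phi t y - phi t x|.
  apply: Rintegral_bound.
  - by rewrite mulr_ge0// divr_ge0 ?pi_ge0// ltW.
  - by move=> s; rewrite /tnorm sqrtr_ge0.
  move=> s _; rewrite mulrAC ler_pdivlMr// mulrC.
  have [cs _] := eased_line_core xc yc s.
  have [_ h] := Hc t _ cs (velocity X (chart_segment t (phi t x) (phi t y)) s).
  apply: (le_trans h); exact: chart_segment_speed.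
have /andP[_ len] := lenE.
apply: (@le_trans _ _ (curve_length g (chart_segment t (phi t x) (phi t y)))).
  apply: ge_inf.
    exists 0 => _ [s _ <-]; apply: sumr_ge0 => c' _.
    rewrite /curve_length /Rintegral fine_ge0// integral_ge0// => u _.
    by rewrite lee_fin /tnorm sqrtr_ge0.
  exists [:: chart_segment t (phi t x) (phi t y)]; last by rewrite big_seq1.
  split; first exact: chart_segment_C1.
    by rewrite /chart_segment /eased_line ease0 scale0r addr0 chartK.
  by rewrite /= /chart_segment /eased_line ease1 scale1r addrC subrK chartK.
apply: (le_trans len); rewrite ler_wpM2l// ?divr_ge0 ?pi_ge0 ?(ltW c0)//.
by rewrite distrC.
Qed.

End DistanceBound.

(** * Hyperbolic sets read in charts *)

(* From here on differentials are handled only through their linearity and the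
   chain rule. *)
#[local] Opaque diff.

(** By the Bernoulli inequality. *)
Lemma exprn_unbounded (R : realType) (a lam : R) : 1 < lam ->
  exists2 m, (0 < m)%N & a <= lam ^+ m.
Proof.
move=> lam1; have d0 : 0 < lam - 1 by rewrite subr_gt0.
have bern m : 1 + m%:R * (lam - 1) <= lam ^+ m.
  elim: m => [|m IH]; first by rewrite mul0r addr0 expr0.
  rewrite exprS; have h : lam * (1 + m%:R * (lam - 1)) <= lam * lam ^+ m.
    by rewrite ler_pM2l// (lt_trans _ lam1).
  apply: (le_trans _ h); rewrite -natr1.
  have : 0 <= m%:R * (lam - 1) * (lam - 1) by rewrite !mulr_ge0// ltW.
  lra.
exists (Num.bound (`|a| / (lam - 1))).+1 => //.
apply: (le_trans _ (bern _)).
have /archi_boundP : 0 <= `|a| / (lam - 1) by rewrite divr_ge0// ltW.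
rewrite ltr_pdivrMr// => /ltW h; rewrite -natr1 mulrDl mul1r.
have := ler_norm a; lra.
Qed.

Section HyperbolicCharts.
Context {R : realType} {n : nat} {M : topologicalType} (X : manifold R n M)
  (g : riemannian X) (A : finite_atlas X).
Implicit Types (i j : chart_index X) (x y : M) (t : 'I_(fa_size A)) (F : M -> M).
Hypothesis M_compact : compact [set: M].
Local Notation ci := (@fa_chart _ _ _ _ A).
Local Notation phi t := (chart (ci t)).
Local Notation psi t := (chart_inv (ci t)).

(** The tangent space at [x] is written in the preferred chart at [x], hence
    [mdiff] and [dchart] are local expressions of [F] and of the identity, and
    the formula is the chain rule for both sides. *)
Lemma dchart_mdiff i j F x v : C1_map X F -> chart_dom i x -> chart_dom j (F x) ->
  local_diff i j F x (dchart i x v) = dchart j (F x) (mdiff X F x v).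
Proof.
move=> CF ix jx.
have mx := mem_chart_at X x; have mFx := mem_chart_at X (F x).
have [_ E1] := @local_comp _ _ _ X _ _ _ id F x (C1_map_id X) CF mx ix jx.
have [_ E2] := @local_comp _ _ _ X _ _ _ F id x CF (C1_map_id X) mx mFx jx.
exact: (etrans (esym (congr1 (fun h => h v) E1)) (congr1 (fun h => h v) E2)).
Qed.

Lemma mdiff_comp F G x v : C1_map X F -> C1_map X G ->
  mdiff X (G \o F) x v = mdiff X G (F x) (mdiff X F x v).
Proof.
move=> CF CG.
have [_ E] := local_comp CF CG (mem_chart_at X x) (mem_chart_at X (F x))
  (mem_chart_at X (G (F x))).
exact: (congr1 (fun h => h v) E).
Qed.

Lemma mdiff_lfunE F x v : linfun (mdiff X F x) v = mdiff X F x v.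
Proof. exact: (lfunE (local_diff (chart_at X x) (chart_at X (F x)) F x) v). Qed.

Lemma dchart_lfunE i x v : linfun (dchart i x) v = dchart i x v.
Proof. exact: (lfunE (local_diff (chart_at X x) i id x) v). Qed.

Lemma orbit_iter f (L : set M) (x : int -> M) (k : int) m :
  full_orbits f L x -> iter m f (x k) = x (k + m%:Z).
Proof.
move=> Lx; elim: m => [|m IH]; first by rewrite addr0.
by rewrite /= IH; have [-> _] := Lx (k + m%:Z); rewrite -addrA intS (addrC 1).
Qed.

Lemma invariant_iter f (L : set M) (x : int -> M) (E : int -> {vspace 'rV[R]_n})
    (k : int) m : C1_map X f -> full_orbits f L x ->
  (forall k, (linfun (mdiff X f (x k)) @: E k)%VS = E (k + 1)) ->
  (linfun (mdiff X (iter m f) (x k)) @: E k)%VS = E (k + m%:Z).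
Proof.
move=> Cf Lx HE; elim: m => [|m IH].
  rewrite addr0 -[RHS]lim1g.
  apply: (congr1 (fun h => (h @: E k)%VS)); apply/lfunP => v.
  rewrite id_lfunE; apply: (etrans (mdiff_lfunE (iter 0 f) (x k) v)).
  exact: local_diff_id (mem_chart_at X (x k)).
have -> : k + m.+1%:Z = (k + m%:Z) + 1 by rewrite -addrA intS (addrC 1).
rewrite -(HE (k + m%:Z)).
rewrite -IH.
apply: (etrans _ (limg_comp _ _ _)).
apply: (congr1 (fun h => (h @: E k)%VS)); apply/lfunP => v.
rewrite comp_lfunE -(orbit_iter k m Lx).
apply: (etrans (mdiff_lfunE (iter m.+1 f) (x k) v)).
apply: (etrans (mdiff_comp (x k) v (C1_map_iter m Cf) Cf)).
apply: (esym (etrans (mdiff_lfunE f _ _) _)).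
exact: (congr1 (mdiff X f (iter m f (x k))) (mdiff_lfunE (iter m f) (x k) v)).
Qed.

Definition chart_space t x (E : {vspace 'rV[R]_n}) : {vspace 'rV[R]_n} :=
  (linfun (dchart (ci t) x) @: E)%VS.

Lemma mem_chart_space t x (E : {vspace 'rV[R]_n}) v :
  v \in E -> dchart (ci t) x v \in chart_space t x E.
Proof.
move=> vE; apply/memv_imgP; exists v => //.
by rewrite dchart_lfunE.
Qed.

Lemma chart_spaceP t x (E : {vspace 'rV[R]_n}) u : u \in chart_space t x E ->
  exists2 v, v \in E & u = dchart (ci t) x v.
Proof.
move=> /memv_imgP[v vE ->]; exists v => //.
by rewrite dchart_lfunE.
Qed.

Lemma chart_space_complement t x (E E' : {vspace 'rV[R]_n}) : chart_dom (ci t) x ->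
  (E + E' = fullv)%VS -> (E :&: E' = 0)%VS ->
  (chart_space t x E + chart_space t x E' = fullv)%VS /\
  (chart_space t x E :&: chart_space t x E' = 0)%VS.
Proof.
move=> tx EE EE0; split.
  apply/eqP; rewrite eqEsubv subvf /chart_space -limgD EE; apply/subvP => v _.
  by rewrite -(dchart_invK v tx); apply: mem_chart_space; rewrite memvf.
apply/eqP; rewrite -subv0; apply/subvP => u; rewrite memv_cap memv0.
move=> /andP[/chart_spaceP[v vE ->] /chart_spaceP[w wE' vw]].
have {vw} vw : v = w by rewrite -(dchartK v tx) vw dchartK.
have : v \in (E :&: E')%VS by rewrite memv_cap vE vw.
by rewrite EE0 memv0 => /eqP ->; rewrite /dchart linear0.
Qed.

(** The spaces [U x k t] and [S x k t] are the unstable and stable spaces at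
    time [k] along the orbit [x], in coordinates of the chart [t]. They depend
    on the whole orbit [x], as an endomorphism has no unstable space at a
    point. *)
Record chart_hyperbolic f (L : set M) (K C lam : R)
    (U S : (int -> M) -> int -> 'I_(fa_size A) -> {vspace 'rV[R]_n}) : Prop :=
  ChartHyperbolic {
  ch_transverse : forall x : int -> M, full_orbits f L x -> forall k t, core 3 t (x k) ->
    transverse K (U x k t) (S x k t) ;
  ch_invariant : forall x : int -> M, full_orbits f L x -> forall (k : int) (m : nat) t t',
    core 3 t (x k) -> core 3 t' (x (k + m%:Z)) ->
    let D := local_diff (ci t) (ci t') (iter m f) (x k) in
    (linfun D @: U x k t)%VS = U x (k + m%:Z) t' /\
    (linfun D @: S x k t)%VS = S x (k + m%:Z) t' ;
  ch_rates : forall x : int -> M, full_orbits f L x -> forall (k : int) (m : nat) t t',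
    (0 < m)%N -> core 3 t (x k) -> core 3 t' (x (k + m%:Z)) ->
    let D := local_diff (ci t) (ci t') (iter m f) (x k) in
    (forall u, u \in U x k t -> C^-1 * lam ^+ m * `|u| <= `|D u|) /\
    (forall s, s \in S x k t -> `|D s| <= C * lam ^- m * `|s|)
}.

(** Invariance and rates are transported by the differentials of the charts, up
    to the constants of [tnorm_bounds]. The uniform angle is a consequence of
    the rates: let [m0] be such that [f^m0] expands the unstable vector [u] by 2
    and contracts the stable vector [s] by 1/2, and let [Lb] bound its
    differential [D]. Then
      [2 |u| <= |D u| <= |D (u + s)| + |D s| <= Lb |u + s| + (|u + s| + |u|) / 2],
    hence [|u| <= (Lb + 1) |u + s|]. *)
Lemma hyperbolic_set_charts f (L : set M) : C1_map X f -> hyperbolic_set g f L ->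
  exists K C lam U S, [/\ 1 <= K, 0 < C, 1 < lam & chart_hyperbolic f L K C lam U S].
Proof.
move=> Cf [_ _ _ [C0 [lam [Es [Eu [C01 lam1 HS _]]]]]].
have [c c0 Hc] := tnorm_bounds g A M_compact.
pose C := C0 / c ^+ 2.
have C00 : 0 < C0 by exact: lt_trans C01.
have Cp : 0 < C by rewrite divr_gt0// exprn_gt0.
pose U (x : int -> M) k t := chart_space t (x k) (Eu x k).
pose S (x : int -> M) k t := chart_space t (x k) (Es x k).
have inv (x : int -> M) (k : int) (m : nat) t t' (E : int -> {vspace 'rV[R]_n}) :
    full_orbits f L x -> core 3 t (x k) -> core 3 t' (x (k + m%:Z)) ->
    (forall k, (linfun (mdiff X f (x k)) @: E k)%VS = E (k + 1)) ->
    (linfun (local_diff (ci t) (ci t') (iter m f) (x k)) @: chart_space t (x k) (E k))%VS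
    = chart_space t' (x (k + m%:Z)) (E (k + m%:Z)).
  move=> Lx [tk _] [tkm _] HE.
  rewrite -(invariant_iter k m Cf Lx HE) /chart_space.
  apply: (etrans (esym (limg_comp _ _ _))); apply: (etrans _ (limg_comp _ _ _)).
  apply: (congr1 (fun h => (h @: E k)%VS)); apply/lfunP => v.
  apply: (etrans (comp_lfunE _ _ _)).
  apply: (etrans _ (esym (comp_lfunE _ _ _))).
  have xE := orbit_iter k m Lx; rewrite -xE in tkm; rewrite -xE.
  apply: (etrans (lfunE (local_diff (ci t) (ci t') (iter m f) (x k)) _)).
  apply: (etrans (congr1 (local_diff (ci t) (ci t') (iter m f) (x k))
    (dchart_lfunE (ci t) (x k) v))).
  apply: (etrans (dchart_mdiff v (C1_map_iter m Cf) tk tkm)).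
  apply: (esym (etrans (dchart_lfunE (ci t') _ _) _)).
  exact: (congr1 (dchart (ci t') (iter m f (x k))) (mdiff_lfunE (iter m f) (x k) v)).
have rates (x : int -> M) : full_orbits f L x -> forall (k : int) (m : nat) t t',
    (0 < m)%N -> core 3 t (x k) -> core 3 t' (x (k + m%:Z)) ->
    let D := local_diff (ci t) (ci t') (iter m f) (x k) in
    (forall u, u \in U x k t -> C^-1 * lam ^+ m * `|u| <= `|D u|) /\
    (forall s, s \in S x k t -> `|D s| <= C * lam ^- m * `|s|).
  move=> Lx k m t t' m0 tk tkm D.
  have [_ _ _ /(_ m m0)[Hu Hs]] := HS x Lx k.
  have Dd v : D (dchart (ci t) (x k) v) =
      dchart (ci t') (iter m f (x k)) (mdiff X (iter m f) (x k) v).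
    apply: (dchart_mdiff v (C1_map_iter m Cf) tk.1).
    by rewrite (orbit_iter k m Lx); exact: tkm.1.
  rewrite -(orbit_iter k m Lx) in tkm.
  have lm0 : 0 < lam ^+ m by rewrite exprn_gt0// (lt_trans _ lam1).
  split=> _ /chart_spaceP[v vE ->]; rewrite Dd.
    have [h1 _] := Hc t _ tk v.
    have [_ h2] := Hc t' _ tkm (mdiff X (iter m f) (x k) v).
    apply: (le_trans _ h2).
    rewrite -(ler_pM2l c0) in h1; have h3 := Hu v vE.
    rewrite -(ler_pM2l c0) in h3; apply: (le_trans _ h3).
    rewrite /C invf_div.
    have -> : c ^+ 2 / C0 * lam ^+ m * `|dchart (ci t) (x k) v| =
        C0^-1 * lam ^+ m * (c * (c * `|dchart (ci t) (x k) v|)) by ring.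
    have -> : c * (C0^-1 * lam ^+ m * tnorm g (x k) v) =
        C0^-1 * lam ^+ m * (c * tnorm g (x k) v) by ring.
    by rewrite ler_pM2l// mulr_gt0// invr_gt0.
  have [_ h1] := Hc t _ tk v.
  have [h2 _] := Hc t' _ tkm (mdiff X (iter m f) (x k) v).
  have h3 := Hs v vE.
  rewrite -(ler_pM2l (exprn_gt0 2 c0)).
  have -> : c ^+ 2 * (C * lam ^- m * `|dchart (ci t) (x k) v|) =
      C0 * lam ^- m * `|dchart (ci t) (x k) v|.
    rewrite /C; field; lra.
  rewrite expr2 -mulrA (le_trans (ler_wpM2l (ltW c0) h2))//.
  rewrite (le_trans (ler_wpM2l (ltW c0) h3))//.
  rewrite mulrCA ler_wpM2l// mulr_ge0 ?invr_ge0 ?(ltW C00)// ltW//.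
have lam0 : 0 < lam by exact: lt_trans lam1.
have [m0 m00 Hm0] := exprn_unbounded (2 * C) lam1.
have lm0 : 0 < lam ^+ m0 by rewrite exprn_gt0.
have [Lb Lb0 HL] := uniformly_bounded_diff A M_compact (C1_map_iter m0 Cf).
exists (Lb + 1), C, lam, U, S; split => //; first by rewrite lerDr ltW.
split=> [x Lx k t tk|x Lx k m t t' tk tkm D|]; last exact: rates.
- have [[EE EE0] _ _ _] := HS x Lx k.
  rewrite addvC capvC in EE EE0.
  have [cc1 cc2] := chart_space_complement tk.1 EE EE0.
  split => // u s uU sS.
  have [t' tkm] := core_cover A (x (k + m0%:Z)).
  have tkm3 : core 3 t' (x (k + m0%:Z)) by apply: core_le tkm; rewrite ler1n.
  have tkm2 : core 2 t' (iter m0 f (x k)).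
    by rewrite (orbit_iter k m0 Lx); apply: core_le tkm; rewrite ler1n.
  have [ru rs] := rates x Lx k m0 t t' m00 tk tkm3.
  have h1 := ru u uU; have h2 := rs s sS.
  have h3 := HL t t' (x k) tk tkm2 (u + s).
  set D := local_diff (ci t) (ci t') (iter m0 f) (x k) in h1 h2 h3.
  have h4 : 2 * `|u| <= `|D u|.
    apply: (le_trans _ h1); rewrite ler_wpM2r// ler_pdivlMl// mulrC.
    exact: Hm0.
  have h5 : `|D s| <= 2^-1 * `|s|.
    apply: (le_trans h2); rewrite ler_wpM2r// ler_pdivrMr// ler_pdivlMl//.
  have h6 : `|D u| <= `|D (u + s)| + `|D s|.
    have -> : D u = D (u + s) - D s by rewrite linearD/= addrK.
    exact: ler_normB.
  have h7 : `|s| <= `|u + s| + `|u|.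
    by rewrite -{1}(addKr u s) addrC ler_normB.
  have h8 := normr_ge0 (u + s).
  have : 2 * `|u| <= Lb * `|u + s| + 2^-1 * (`|u + s| + `|u|).
    apply: (le_trans h4); apply: (le_trans h6); apply: lerD => //.
    by apply: (le_trans h5); rewrite ler_pM2l.
  have := mulr_ge0 (ltW Lb0) h8; move: h8; clear.
  rewrite mulrDl mul1r.
  by move: (Lb * `|u + s|) (`|u + s|) (`|u|) => p q r; lra.
- by split; apply: inv => // k'; have [] := HS x Lx k'.
Qed.

End HyperbolicCharts.

(** * Shadowing a pseudo-orbit with one jump *)

Section ShadowingOnManifold.
Context {R : realType} {n : nat} {M : topologicalType} (X : manifold R n M)
  (A : finite_atlas X).
Implicit Types (t : 'I_(fa_size A)) (F : M -> M).
Hypothesis M_compact : compact [set: M].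
Local Notation ci := (@fa_chart _ _ _ _ A).
Local Notation phi t := (chart (ci t)).
Local Notation psi t := (chart_inv (ci t)).

(** The past of [b] is chosen by iterating a right inverse of [f] on [B]. *)
Lemma orbit_through f (B : set M) b : f @` B = B -> B b ->
  exists2 x : int -> M, full_orbits f B x & x 0 = b.
Proof.
move=> fB Bb.
have /choice[pre Hpre] : forall z, exists w, B z -> B w /\ f w = z.
  move=> z; have [Bz|nBz] := pselect (B z); last by exists z.
  by have : (f @` B) z by [rewrite fB]; move=> [w Bw wz]; exists w.
have Bpre m : B (iter m pre b).
  by elim: m => [|m IH] //=; have [] := Hpre _ IH.
have Bf m : B (iter m f b).
  by elim: m => [|m IH] //=; rewrite -fB; exists (iter m f b).
exists (fun k : int => match k with Posz m => iter m f b | Negz m => iter m.+1 pre b end) => //.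
move=> [m|m]; first by rewrite -PoszD addn1.
split; last exact: Bpre.
have [_ fp] := Hpre _ (Bpre m).
rewrite /= fp NegzE -addn1 PoszD opprD subrK.
by case: m {fp} => [|m]; rewrite ?oppr0// -NegzE.
Qed.

Lemma iter_image f (B : set M) m : f @` B = B -> iter m f @` B = B.
Proof.
move=> fB; elim: m => [|m IH]; first by rewrite /= image_id.
rewrite -{2}fB -{2}IH; apply/seteqP; split => [_ [x Bx <-]|_ [_ [x Bx <-] <-]].
  by exists (iter m f x) => //; exists x.
by exists x.
Qed.

(** The orbit [xa] arrives at time [N] close to the starting point of [xb]. The
    differentials of [f^N] at these two points are close, so [graph_transform]
    applies to them with the splitting along [xa] at the source and the one
    along [xb] at the target. Its estimates pass from the differential at
    [xb 0] to the increments of the map [H] with an additional error [e]. *)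
Lemma orbit_transition f (L : set M) (K C lam : R)
    (U S : (int -> M) -> int -> 'I_(fa_size A) -> {vspace 'rV[R]_n})
    (N : nat) (e r : R) :
  C1_map X f -> chart_hyperbolic f L K C lam U S ->
  (0 < N)%N -> 1 <= K -> 0 < e -> 4 * K * e <= 1 ->
  C * lam ^- N <= e -> 2 * K <= e * (C^-1 * lam ^+ N) ->
  (forall t t' x, core 3 t x -> core 2 t' (iter N f x) ->
    (forall v, `|v - phi t x| <= r ->
       chart_img (ci t) v /\ core 3 t' (iter N f (psi t v))) /\
    (forall v v', `|v - phi t x| <= r -> `|v' - phi t x| <= r ->
       `|local_map (ci t) (ci t') (iter N f) v - local_map (ci t) (ci t') (iter N f) v' -
           local_diff (ci t) (ci t') (iter N f) x (v - v')| <= e * `|v - v'|)) ->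
  forall (xa xb : int -> M) t t', full_orbits f L xa -> full_orbits f L xb ->
    core 3 t (xa N) -> core 3 t (xb 0) -> `|phi t (xa N) - phi t (xb 0)| < r ->
    core 2 t' (xb N) ->
  let P := daddv_pi (U xa N t) (S xa N t) in
  let P' := daddv_pi (U xb N t') (S xb N t') in
  let H := local_map (ci t) (ci t') (iter N f) in
  exists g : 'End('rV[R]_n),
  [/\ forall v, P (g v) = g v, forall v, g v = 0 -> P' v = 0,
      forall v, `|g v| <= e * `|v|,
      forall v v', `|v - phi t (xb 0)| <= r -> `|v' - phi t (xb 0)| <= r ->
        `|(H v - H v') - P' (H v - H v')| <= 12 * K * K * e * `|v - v'| &
      forall v v', `|v - phi t (xb 0)| <= r -> `|v' - phi t (xb 0)| <= r ->
        `|P (v - v') - g (H v - H v')| <= 2 * e * `|v - v'|].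
Proof.
move=> Cf HU N0 K1 e0 eK rate1 rate2 Hr xa xb t t' La Lb ta tb abr t'b P P' H.
have [_ CF2] := C1_map_iter N Cf.
have xbN : iter N f (xb 0) = xb N by rewrite (orbit_iter 0 N Lb) add0r.
have t'Fb : core 2 t' (iter N f (xb 0)) by rewrite xbN.
have [Hr1 Hr2] := Hr t t' (xb 0) tb t'Fb.
have le23 : 2 <= 3 :> R by rewrite ler_nat.
have t'b3 : core 3 t' (xb (0 + N%:Z)) by rewrite add0r; exact: core_le t'b.
have t'a : core 3 t' (xa (N%:Z + N%:Z)).
  rewrite -(orbit_iter N%:Z N La).
  by have [_] := Hr1 _ (ltW abr); rewrite chartK//; exact: ta.1.
set DA := local_diff (ci t) (ci t') (iter N f) (xb 0) in Hr2.
set DB := local_diff (ci t) (ci t') (iter N f) (xa N).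
have [AU AS] := ch_invariant HU Lb tb t'b3.
have [rU' rS'] := ch_rates HU Lb N0 tb t'b3.
have [rU rS] := ch_rates HU La N0 ta t'a.
rewrite -/DA in AU AS rU' rS'; rewrite -/DB in rU rS.
rewrite add0r in AU AS t'b3.
have AB0 v : `|DB v - DA v| <= e * `|v|.
  apply: (@diff_close _ _ _ H (phi t (xa N)) (phi t (xb 0)) DA r) => //.
  apply: CF2; first exact: ta.1.
  by rewrite (orbit_iter N%:Z N La); exact: t'a.1.
have {}Hr2 v v' : `|v - phi t (xb 0)| <= r -> `|v' - phi t (xb 0)| <= r ->
    `|H v - H v' - DA (v - v')| <= e * `|v - v'| by exact: Hr2.
clearbody DA DB H.
have AB v : `|linfun DA v - linfun DB v| <= e * `|v|.
  by rewrite !lfunE distrC.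
have trb := ch_transverse HU Lb t'b3.
have [|||||g [g1 g2 g3 g4 g5]] := graph_transform K1 e0 eK rate2
    (ch_transverse HU La ta) (ch_transverse HU Lb tb) trb AU _ AB.
- by rewrite AS subvv.
- move=> v vS; rewrite lfunE (le_trans (rS v vS))// ler_wpM2r//.
- by move=> v vU; rewrite lfunE; exact: rU.
- move=> v vS; rewrite lfunE (le_trans (rS' v vS))// ler_wpM2r//.
- by move=> v vU; rewrite lfunE; exact: rU'.
have K0 : 0 <= K by rewrite (le_trans _ K1).
rewrite -/P -/P' in g1 g2.
have {}g4 w : `|DA w - P' (DA w)| <= 10 * K * K * e * `|w|.
  by have := g4 w; rewrite lfunE.
have {}g5 w : `|P w - g (DA w)| <= e * `|w| by have := g5 w; rewrite lfunE.
have h3 w : `|w - P' w| <= 2 * K * `|w| by exact: transverse_proj_compl.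
have e1 : e <= 1.
  rewrite (le_trans _ eK)// mulrC ler_peMr ?(ltW e0)//.
  by rewrite (le_trans K1)// ler_peMl// ler1n.
have KK : 2 * K <= 2 * K * K by rewrite ler_peMr// mulr_ge0.
clearbody P P'; clear AU AS rU' rS' rU rS AB AB0.
exists g; split => // v v' vr v'r.
  have h1 := Hr2 v v' vr v'r; set w := v - v' in h1 *; set D := H v - H v' in h1 *; clearbody w D.
  have -> : D - P' D = (DA w - P' (DA w)) + ((D - DA w) - P' (D - DA w)).
    by rewrite addrACA -opprD -linearD/= (addrC (DA w)) subrK.
  apply: (le_trans (ler_normD _ _)).
  have -> : 12 * K * K * e * `|w| = 10 * K * K * e * `|w| + 2 * K * K * (e * `|w|).
    by ring.
  apply: lerD => //; apply: (le_trans (h3 _)).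
  apply: (@le_trans _ _ (2 * K * (e * `|w|))).
    by apply: ler_wpM2l => //; rewrite mulr_ge0.
  by apply: ler_wpM2r => //; rewrite mulr_ge0// ltW.
have h1 := Hr2 v v' vr v'r; set w := v - v' in h1 *; set D := H v - H v' in h1 *; clearbody w D.
have -> : P w - g D = (P w - g (DA w)) - g (D - DA w).
  by rewrite (linearB g) opprB addrA subrK.
apply: (le_trans (ler_normB _ _)); rewrite -mulrA mulr2n mulrDl !mul1r.
apply: lerD => //; apply: (le_trans (g3 _)).
by rewrite (le_trans _ h1)// ler_piMl.
Qed.

End ShadowingOnManifold.

Section PseudoOrbits.
Context {R : realType} {n : nat} {M : topologicalType} (X : manifold R n M)
  (A : finite_atlas X).
Implicit Types (t : 'I_(fa_size A)) (F : M -> M).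
Hypothesis M_compact : compact [set: M].
Local Notation ci := (@fa_chart _ _ _ _ A).
Local Notation phi t := (chart (ci t)).
Local Notation psi t := (chart_inv (ci t)).

Let subSn_leq (k q : nat) : (k.+1 - q <= (k - q).+1)%N.
Proof. lia. Qed.

Lemma min_radius : exists2 r, 0 < r & forall t, r <= fa_radius t.
Proof.
have : \forall r \near (0 : R)^'+, 0 < r /\ forall t, r <= fa_radius t.
  apply: filterI; first exact: nbhs_right_gt.
  apply: (@filter_forall _ _ (fun t r => r <= fa_radius t) (0 : R)^'+) => t.
  exact/nbhs_right_le/fa_radius_gt0.
by move=> /filter_ex[r [r0 Hr]]; exists r.
Qed.

(** The pseudo-orbit [c] is obtained from [c 0] by replacing [c k] by [y k]
    before applying [f^N], where [y k = c k] except at the time [q] of the jump.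
    The points [b k] of [B] stay close to it and provide the hyperbolicity: the
    splitting used at time [k.+1] is the one at time [N] along a full orbit of
    [B] through [b k], whose point at time [N] is close to [c k.+1]. Then [rho1]
    and [N] do not depend on the lengths, and only the size [del] of the jump
    depends on the required precision [rho]. *)
Lemma shadow_one_jump f (L B : set M) (K C lam : R)
    (U S : (int -> M) -> int -> 'I_(fa_size A) -> {vspace 'rV[R]_n}) :
  C1_map X f -> chart_hyperbolic f L K C lam U S ->
  1 <= K -> 0 < C -> 1 < lam -> B `<=` L -> f @` B = B ->
  exists (N : nat) (rho1 : R), [/\ (0 < N)%N, 0 < rho1 &
    forall rho, 0 < rho -> rho <= rho1 -> exists2 del, 0 < del &
    forall (q m : nat) (c b y : nat -> M), B (c 0%N) ->
      (forall k, (k < m)%N -> [/\ B (b k), chart_close A rho1 (b k) (c k),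
         chart_close A rho1 (b k) (y k) & c k.+1 = iter N f (y k)]) ->
      (forall k, (k < m)%N -> k != q -> y k = c k) ->
      ((q < m)%N -> chart_close A del (y q) (c q)) ->
      exists w, forall k, (k <= m)%N ->
        chart_close A (rho / 2 ^+ (k - q)) (iter k (iter N f) w) (c k)].
Proof.
move=> Cf HU K1 C0 lam1 BL fB.
have K0 : 0 < K by rewrite (lt_le_trans _ K1).
have lam0 : 0 < lam by rewrite (lt_trans _ lam1).
(* The largest error below, 12 * K * K * e, must be at most the contraction
   constant 1/8 of the shadowing lemma. *)
pose e := (96 * K * K)^-1.
have KKp : 0 < 96 * K * K by rewrite !mulr_gt0.
have e0 : 0 < e by rewrite invr_gt0.
have KeE : 96 * K * K * e = 1 by rewrite divff// gt_eqF.
have Ke1 : K * e <= K * K * e by rewrite ler_pM2r// ler_peMr// ltW.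
have e1 : e <= K * e by rewrite ler_peMl// ltW.
have eK : 4 * K * e <= 1 by lra.
have e8 : e <= 8^-1 by lra.
have e28 : 2 * e <= 8^-1 by lra.
have e12 : 12 * K * K * e <= 8^-1 by lra.
have K20 : 0 <= 2 * K by rewrite mulr_ge0// ltW.
have [N N0 HN] := exprn_unbounded (Num.max (C / e) (C * (2 * K / e))) lam1.
have lN0 : 0 < lam ^+ N by rewrite exprn_gt0.
have [HN1 HN2] : C / e <= lam ^+ N /\ C * (2 * K / e) <= lam ^+ N.
  by move: HN; rewrite ge_max => /andP.
have rate1 : C * lam ^- N <= e.
  by rewrite ler_pdivrMr// mulrC -ler_pdivrMr.
have rate2 : 2 * K <= e * (C^-1 * lam ^+ N).
  by rewrite [leRHS]mulrC -ler_pdivrMr// ler_pdivlMl.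
have CF := C1_map_iter N Cf.
have [r r0 Hr] := uniformly_C1 A M_compact CF e0.
have r4 : r / 4 + r / 4 < r by lra.
have [rm rm0 Hrm] := min_radius.
pose r1 := Num.min (r / 4) rm.
have r10 : 0 < r1 by rewrite lt_min rm0 andbT divr_gt0.
have r1r : r1 <= r / 4 by rewrite ge_min lexx.
have r1m t : r1 <= fa_radius t by rewrite (le_trans _ (Hrm t))// ge_min lexx orbT.
clearbody r1.
have [d1 d10 Hd1] := uniformly_continuous_close A M_compact CF r10.
have [d2 d20 Hd2] := uniformly_continuous_close A M_compact (C1_map_id X) r10.
pose rho1 := Num.min r1 (Num.min d1 d2).
have rho10 : 0 < rho1 by rewrite !lt_min r10 d10 d20.
have rho1r : rho1 <= r1 by rewrite ge_min lexx.
have rho1d1 : rho1 <= d1 by rewrite !ge_min lexx orbT.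
have rho1d2 : rho1 <= d2 by rewrite !ge_min lexx !orbT.
exists N, rho1; split => // rho rho0 rhole.
(* After the jump the allowed error is rho / 2, and the projection onto the
   stable space multiplies the jump by at most 2 * K. This leaves 1/8 of it. *)
have j0 : 0 < rho / (32 * K) by rewrite divr_gt0// mulr_gt0.
have [dj dj0 Hdj] := uniformly_continuous_close A M_compact CF j0.
exists dj => // q m c b y Bc0 Hstep Hy Hjump.
have /choice[orb Ho] : forall z, exists x : int -> M, B z -> full_orbits f B x /\ x 0 = z.
  move=> z; have [Bz|nBz] := pselect (B z); last by exists (fun=> z).
  by have [x] := orbit_through fB Bz; exists x.
(* The shift by one: at time 0 the splitting comes from an orbit of B that
   arrives at c 0 itself. *)
have [a0 Ba0 a0E] : (iter N f @` B) (c 0%N) by rewrite iter_image.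
pose bb k := if k is k'.+1 then b k' else a0.
have Bbb k : (k <= m)%N -> B (bb k).
  by case: k => [|k] // km; have [] := Hstep k km.
have ofull k : (k <= m)%N -> full_orbits f L (orb (bb k)) /\ orb (bb k) 0 = bb k.
  move=> /Bbb /Ho[oB orb0]; split => // i; have [-> Bi] := oB i; split=> //.
  exact: BL.
pose d k := iter N f (bb k).
have oN k : (k <= m)%N -> orb (bb k) N = d k.
  by move=> /ofull[oL orb0]; rewrite /d -{2}orb0 (orbit_iter 0 N oL) add0r.
have /choice[tt Htt] := @core_cover _ _ _ _ A.
pose t k := tt (d k).
have td1 k : core 1 (t k) (d k) by exact: Htt.
have td k a : 1 <= a -> core a (t k) (d k) by move=> a1; exact: core_le (td1 k).
have le12 : 1 <= 2 :> R by rewrite ler1n.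
have le13 : 1 <= 3 :> R by rewrite ler1n.
(* The chart t k is chosen so that the point d k of B is in its smallest ball.
   The steps from d k to c k and from c k to b k enlarge the ball by one radius
   each. *)
have f1 k : (k <= m)%N -> core 3 (t k) (c k) /\
    `|phi (t k) (d k) - phi (t k) (c k)| <= r1.
  case: k => [_|k km].
    have -> : c 0%N = d 0%N by rewrite /d a0E.
    by rewrite subrr normr0 ltW//; split=> //; exact: td.
  have [Bb bc by_ ->] := Hstep k km.
  exact: (Hd1 (b k) (y k) (chart_close_le rho1d1 by_) (t k.+1) (td k.+1 _ le12)).
have f2 k : (k <= m)%N -> core 2 (t k) (c k).
  move=> /f1[[tc _] dc]; split => //.
  rewrite -(subrKA (phi (t k) (d k))) (le_trans (ler_normD _ _))//.
  rewrite mulrDl !mul1r lerD//; first by rewrite distrC (le_trans dc).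
  by have [_] := td1 k; rewrite mul1r.
have f3 k : (k < m)%N -> core 3 (t k) (b k) /\
    `|phi (t k) (c k) - phi (t k) (b k)| <= r1.
  move=> km; have [_ bc _ _] := Hstep k km.
  have h := Hd2 (c k) (b k) (chart_close_le rho1d2 (chart_close_sym bc)) (t k) (f2 k (ltnW km)).
  exact: h.
pose P k := daddv_pi (U (orb (bb k)) N (t k)) (S (orb (bb k)) N (t k)).
pose H k := local_map (ci (t k)) (ci (t k.+1)) (iter N f).
have trans k : (k < m)%N -> exists g : 'End('rV[R]_n),
  [/\ forall v, P k (g v) = g v, forall v, g v = 0 -> P k.+1 v = 0,
      forall v, `|g v| <= e * `|v|,
      forall v v', `|v - phi (t k) (b k)| <= r -> `|v' - phi (t k) (b k)| <= r ->
        `|(H k v - H k v') - P k.+1 (H k v - H k v')| <= 12 * K * K * e * `|v - v'| &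
      forall v v', `|v - phi (t k) (b k)| <= r -> `|v' - phi (t k) (b k)| <= r ->
        `|P k (v - v') - g (H k v - H k v')| <= 2 * e * `|v - v'|].
  move=> km; have [La _] := ofull k (ltnW km).
  have [Lb ob] := ofull k.+1 km.
  have := orbit_transition Cf HU N0 K1 e0 eK rate1 rate2 Hr (t := t k) (t' := t k.+1) La Lb.
  rewrite (oN k (ltnW km)) (oN k.+1 km) ob; apply.
  - exact: td.
  - by have [] := f3 k km.
  - have [_ h1] := f1 k (ltnW km); have [_ h2] := f3 k km.
    rewrite -(subrKA (phi (t k) (c k))) (le_lt_trans (ler_normD _ _))//.
    by rewrite (le_lt_trans (lerD h1 h2))// (le_lt_trans (lerD r1r r1r)).
  - exact: td.
have /choice[g Hg] : forall k, exists gk : 'End('rV[R]_n), (k < m)%N ->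
  [/\ forall v, P k (gk v) = gk v, forall v, gk v = 0 -> P k.+1 v = 0,
      forall v, `|gk v| <= e * `|v|,
      forall v v', `|v - phi (t k) (b k)| <= r -> `|v' - phi (t k) (b k)| <= r ->
        `|(H k v - H k v') - P k.+1 (H k v - H k v')| <= 12 * K * K * e * `|v - v'| &
      forall v v', `|v - phi (t k) (b k)| <= r -> `|v' - phi (t k) (b k)| <= r ->
        `|P k (v - v') - gk (H k v - H k v')| <= 2 * e * `|v - v'|].
  move=> k; case: (ltnP k m) => [km|]; last by exists 0.
  by have [gk Hgk] := trans k km; exists gk.
pose rh k : R := rho / 2 ^+ (k - q).
have rh0 k : 0 < rh k by rewrite divr_gt0// exprn_gt0.
have rhle k : rh k <= rho.
  by rewrite ler_pdivrMr ?exprn_gt0// ler_peMr ?(ltW rho0)// exprn_ege1// ler1n.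
have rhS k : rh k <= 2 * rh k.+1.
  rewrite /rh ler_pdivrMr ?exprn_gt0//.
  set a := (k - q)%N; set b' := (k.+1 - q)%N.
  have -> : 2 * (rho / 2 ^+ b') * 2 ^+ a = rho * ((2 * 2 ^+ a) / 2 ^+ b') by ring.
  rewrite ler_peMr ?(ltW rho0)// ler_pdivlMr ?exprn_gt0// mul1r -exprS.
  by rewrite ler_eXn2l ?ltr1n//; exact: subSn_leq.
have rhS' k : rh k.+1 <= 2 * rh k.
  have h : rh k.+1 <= rh k.
    rewrite ler_pM2l// lef_pV2 ?posrE ?exprn_gt0// ler_eXn2l ?ltr1n//.
    exact: leq_sub2r.
  by rewrite (le_trans h)// ler_peMl ?ler1n// ltW.
have rho1r4 : rho1 <= r / 4 by exact: le_trans r1r.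
have inball k v : (k < m)%N -> `|v - phi (t k) (c k)| <= rh k ->
    `|v - phi (t k) (b k)| <= r.
  move=> km vc; have [_ h] := f3 k km.
  rewrite -(subrKA (phi (t k) (c k))) (le_trans (ler_normD _ _))//.
  have h1 : `|v - phi (t k) (c k)| <= r / 4.
    by rewrite (le_trans vc)// (le_trans (rhle k))// (le_trans rhole).
  have h2 : `|phi (t k) (c k) - phi (t k) (b k)| <= r / 4 by exact: le_trans r1r.
  by rewrite (le_trans (lerD h1 h2))// ltW.
have trk k : (k <= m)%N -> transverse K (U (orb (bb k)) N (t k)) (S (orb (bb k)) N (t k)).
  move=> km; have [La _] := ofull k km; apply: (ch_transverse HU La).
  by rewrite oN//; exact: td.
have jump k : (k < m)%N ->
    `|H k (phi (t k) (c k)) - phi (t k.+1) (c k.+1)| <= rh k.+1 / (16 * K) /\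
    `|H k (phi (t k) (c k)) - phi (t k.+1) (c k.+1)| <= rh k.
  move=> km; have [_ _ _ cS] := Hstep k km.
  have [[tc _] _] := f1 k (ltnW km).
  rewrite /H /local_map /= (chartK tc) cS.
  have [kq|kq] := eqVneq k q; last first.
    rewrite (Hy k km kq) subrr normr0; split; last exact: ltW.
    by apply: ltW; rewrite divr_gt0// mulr_gt0.
  have cl : chart_close A dj (y k) (c k) by rewrite kq; apply: Hjump; rewrite -kq.
  have := f2 k.+1 km; rewrite cS => /(Hdj _ _ cl)[_]; rewrite distrC => h.
  have rq : rh k = rho by rewrite /rh kq subnn expr0 divr1.
  have rq1 : rh k.+1 = rho / 2 by rewrite /rh kq subSnn expr1.
  rewrite rq rq1; split; apply: (le_trans h).
    by rewrite -mulrA -invfM (_ : 2 * (16 * K) = 32 * K)//; ring.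
  rewrite ler_pdivrMr ?mulr_gt0// ler_peMr ?(ltW rho0)//.
  by rewrite (le_trans K1)// ler_peMl ?(ltW K0)// ler1n.
have [|||||||||||||z [Hz1 Hz2]] := @shadowing R n m H
    (fun k => phi (t k) (c k)) P g rh (8^-1).
- by [].
- by rewrite mulVf.
- by move=> k; exact: ltW.
- exact: rhS.
- exact: rhS'.
- move=> k v km; apply: daddv_pi_proj; by case: (trk k km).
- by move=> k v km; have [h _ _ _ _] := Hg k km.
- by move=> k v km; have [_ h _ _ _] := Hg k km; exact: h.
- move=> k v km; have [_ _ h _ _] := Hg k km.
  by apply: (le_trans (h v)); apply: ler_wpM2r.
- move=> k v v' km vc v'c; have [_ _ _ h _] := Hg k km.
  apply: (le_trans (h v v' (inball k v km vc) (inball k v' km v'c))).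
  exact: ler_wpM2r.
- move=> k v v' km vc v'c; have [_ _ _ _ h] := Hg k km.
  apply: (le_trans (h v v' (inball k v km vc) (inball k v' km v'c))).
  exact: ler_wpM2r.
- move=> k km; have [h1 _] := jump k km.
  apply: (le_trans (transverse_proj_compl _ K1 (trk k.+1 km))).
  apply: (le_trans (ler_wpM2l K20 h1)).
  rewrite (_ : 2 * K * (rh k.+1 / (16 * K)) = 8^-1 * rh k.+1)//.
  by field; rewrite gt_eqF.
- move=> k km; have [_ h1] := jump k km; have [_ _ h _ _] := Hg k km.
  apply: (le_trans (h _)); apply: ler_pM => //; exact: ltW.
pose w k := psi (t k) (z k).
have wk k : (k <= m)%N -> core 3 (t k) (w k) /\ phi (t k) (w k) = z k.
  case: k => [_|k km].
    apply: core_chart_inv; first by rewrite ler_nat.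
    have c0d : c 0%N = d 0%N by rewrite /d a0E.
    have h1 := Hz1 0%N (leq0n m); have [_ h2] := td1 0%N.
    rewrite c0d in h1; rewrite mul1r in h2.
    rewrite -(subrKA (phi (t 0%N) (d 0%N))) (le_trans (ler_normD _ _))//.
    have h3 : rh 0%N <= fa_radius (t 0%N).
      by rewrite (le_trans (rhle _))// (le_trans rhole)// (le_trans rho1r).
    have rad0 := fa_radius_gt0 (t 0%N).
    apply: (le_trans (lerD (le_trans h1 h3) h2)).
    by rewrite -mulr2n -[leLHS]mulr_natl ler_pM2r// ler_nat.
  have zb := inball k _ km (Hz1 k (ltnW km)).
  have [tb3 _] := f3 k km; have tF : core 2 (t k.+1) (iter N f (b k)) by exact: td.
  have [/(_ _ zb) [iz tz] _] := Hr _ _ _ tb3 tF.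
  have -> : w k.+1 = iter N f (psi (t k) (z k)).
    by rewrite /w Hz2// /H /local_map /= chartK//; exact: tz.1.
  by split=> //; rewrite Hz2.
have wS k : (k < m)%N -> w k.+1 = iter N f (w k).
  move=> km; have zb := inball k _ km (Hz1 k (ltnW km)).
  have [tb3 _] := f3 k km; have tF : core 2 (t k.+1) (iter N f (b k)) by exact: td.
  have [/(_ _ zb) [iz tz] _] := Hr _ _ _ tb3 tF.
  by rewrite /w Hz2// /H /local_map /= chartK//; exact: tz.1.
have wE k : (k <= m)%N -> iter k (iter N f) (w 0%N) = w k.
  elim: k => [_|k IH km]; first exact: erefl.
  by apply: (etrans (congr1 (iter N f) (IH (ltnW km)))); rewrite -wS.
exists (w 0%N) => k km; rewrite wE//; exists (t k).
have [tw wz] := wk k km; have [tc _] := f1 k km.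
by split=> //; rewrite wz; exact: Hz1.
Qed.

End PseudoOrbits.

(** * A repeller with nonempty interior is open *)

Section RepellerIsOpen.
Context {R : realType} {n : nat} {M : topologicalType} (X : manifold R n M)
  (g : riemannian X) (A : finite_atlas X).
Hypothesis M_compact : compact [set: M].

Lemma iter_chart_close F (e : R) (m : nat) : C1_map X F -> 0 < e ->
  exists2 d, 0 < d & forall r x y, (r < m)%N -> chart_close A d x y ->
    chart_close A e (iter r F x) (iter r F y).
Proof.
move=> CF e0; elim: m => [|m [d d0 Hd]]; first by exists 1.
have [d' d'0 Hd'] := uniformly_continuous_close A M_compact (C1_map_iter m CF) e0.
exists (Num.min d d'); first by rewrite lt_min d0.
move=> r x y; rewrite ltnS leq_eqVlt => /orP[/eqP ->|rm] xy.
  have [t tx] := core_cover A (iter m F x).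
  have tx2 : core 2 t (iter m F x) by apply: core_le tx; rewrite ler1n.
  have xy' : chart_close A d' x y.
    by apply: chart_close_le xy; rewrite ge_min lexx orbT.
  have [ty h] := Hd' x y xy' t tx2.
  by exists t; split => //; apply: core_le tx; rewrite ler1n.
by apply: Hd => //; apply: chart_close_le xy; rewrite ge_min lexx.
Qed.

(** The two orbits are compared at the multiples of [N] only. The fewer than [N]
    steps in between are absorbed by uniform continuity. *)
Lemma stable_set_of_close f N (rho : R) w y : C1_map X f -> (0 < N)%N -> 0 < rho ->
  (forall j, (0 < j)%N ->
     chart_close A (rho / 2 ^+ j) (iter j (iter N f) w) (iter j (iter N f) y)) ->
  stable_set g f w y.
Proof.
move=> Cf N0 rho0 Hwy; have [D D0 HD] := dist_le_chart_close g A M_compact.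
apply/cvgrPdist_le => e e0.
have [d d0 Hd] := iter_chart_close N Cf (divr_gt0 e0 D0).
have [J J0 HJ] := @exprn_unbounded R (rho / d) 2 (ltr1n _ 2).
exists (J * N)%N => // m /= Jm.
have mE : m = (m %% N + m %/ N * N)%N by rewrite addnC -divn_eq.
have Jj : (J <= m %/ N)%N by rewrite leq_divRL.
have jd : rho / 2 ^+ (m %/ N) <= d.
  rewrite ler_pdivrMr ?exprn_gt0// mulrC -ler_pdivrMr// (le_trans HJ)//.
  by rewrite ler_eXn2l// ltr1n.
have cl := chart_close_le jd (Hwy _ (leq_trans J0 Jj)).
have rN : (m %% N < N)%N by rewrite ltn_mod.
have := HD _ _ _ (Hd _ _ _ rN cl).
rewrite -!iterM -!iterD -mE mulrC divfK ?gt_eqF// => h.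
by rewrite sub0r normrN ger0_norm//; exact: dist_ge0.
Qed.

(** A local diffeomorphism is open, so the first iterates of an interior point
    of an invariant set are interior points too. They are all needed because
    transitivity of [f] yields a time that need not be a multiple of the exponent
    of the iterate in use: the remainder is spent near [p]. *)
Lemma iter_deep_inside f (B : set M) (p : M) m : local_diffeo X f -> f @` B = B -> nbhs p B ->
  exists2 e : R, 0 < e & \forall x \near p, forall r y, (r < m)%N ->
    chart_close A e (iter r f x) y -> B y.
Proof.
move=> lf fB Bp.
have Bpr r : nbhs (iter r f p) B.
  elim: r => [|r IH] //=; have := local_diffeo_nbhs_image lf IH.
  by rewrite [X in X -> _]/(nbhs _ (f @` B)) fB.
elim: m => [|m [e e0 He]]; first by exists 1 => //; apply: nearW.
have [e' e'0 He'] := chart_close_in_nbhs A (Bpr m).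
exists (Num.min e e'); first by rewrite lt_min e0.
have {}He' : \forall x \near p, forall y, chart_close A e' (iter m f x) y -> B y.
  exact: ((C1_map_iter m (local_diffeo_C1 lf)).1 p _ He').
apply: filterS2 He He' => x H1 H2 r y; rewrite ltnS leq_eqVlt.
move=> /orP[/eqP ->|rm] xy.
  by apply: H2; apply: chart_close_le xy; rewrite ge_min lexx orbT.
by apply: (H1 r) => //; apply: chart_close_le xy; rewrite ge_min lexx.
Qed.

(** Each condition on [w] is closed and concerns finitely many iterates, so it
    holds at a cluster point of the approximate solutions. *)
Lemma limit_shadow F (B : set M) y (rho : nat -> R) : C1_map X F -> compact B ->
  (forall m, exists2 w, B w & forall j, (0 < j <= m)%N ->
     chart_close A (rho j) (iter j F w) (iter j F y)) ->
  exists2 w, B w & forall j, (0 < j)%N ->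
     chart_close A (rho j) (iter j F w) (iter j F y).
Proof.
move=> CF cB H.
have /choice[w_ Hw] : forall m, exists w, B w /\ forall j, (0 < j <= m)%N ->
     chart_close A (rho j) (iter j F w) (iter j F y).
  by move=> m; have [w Bw Hw] := H m; exists w.
have GB : (w_ @ \oo) B by exists 0%N => // m _; have [] := Hw m.
have [w [Bw cw]] := cB _ _ GB.
exists w => // j j0.
have cl := @chart_close_closed _ _ _ _ A _ (rho j) (iter j F y) (C1_map_iter j CF).1.
apply: (cl w) => V Vw; apply: cw => //.
exists j => // m /= jm; have [_] := Hw m; apply.
by rewrite j0.
Qed.

(** Every [y0] close enough to [z] is asymptotic to a point of [B], found by
    shadowing [x, F x, ..., F^q x, F y0, F^2 y0, ...] on longer and longer
    pieces. *)
Lemma repeller_nbhs f (L B : set M) : local_diffeo X f -> hyperbolic_set g f L ->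
  B `<=` L -> compact B -> f @` B = B -> transitive_on f B ->
  \bigcup_(x in B) stable_set g f x `<=` B -> interior B !=set0 ->
  forall z, B z -> nbhs z B.
Proof.
move=> lf hypL BL cB fB trB stB [p pB] z Bz.
have Cf := local_diffeo_C1 lf.
have [K [C [lam [U [S [K1 C0 lam1 HU]]]]]] := hyperbolic_set_charts A M_compact Cf hypL.
have [N [rho1 [N0 rho10 HS]]] := shadow_one_jump M_compact Cf HU K1 C0 lam1 BL fB.
have [rd rd0 Hdeep] := iter_deep_inside N lf fB pB.
pose rho := Num.min rho1 rd.
have rho0 : 0 < rho by rewrite lt_min rho10.
have rho_1 : rho <= rho1 by rewrite ge_min lexx.
have rho_d : rho <= rd by rewrite ge_min lexx orbT.
have [del del0 Hdel] := HS rho rho0 rho_1.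
have m0 : 0 < Num.min del rho1 by rewrite lt_min del0.
have [W Wz HW] := nbhs_chart_close A z m0.
apply: (filterS _ Wz) => y0 Wy0.
pose F := iter N f.
have FB : F @` B = B by exact: iter_image.
have iB j x : B x -> B (iter j F x).
  by move=> Bx; elim: j => [|j IH] //=; rewrite -FB; exists (iter j F x).
have [x [q [Bx0 Hx1 Wx]]] : exists x q, [/\ B x, forall y, chart_close A rd x y -> B y
    & W (iter q F x)].
  have [||m1 [m10 [_ [[x [x1 Bx] <-] [x2 _]]]]] := trB _ _ (open_interior
    [set x | forall r y, (r < N)%N -> chart_close A rd (iter r f x) y -> B y])
    (open_interior W).
  - by exists p; split => //; exact: nbhs_singleton pB.
  - by exists z; split => //; exact: Wz.
  exists (iter (m1 %% N) f x), (m1 %/ N)%N; split.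
  - rewrite -(iter_image (m1 %% N) fB); by exists x.
  - move=> y; have /(_ (m1 %% N)%N y) := interior_subset x1; apply.
    by rewrite ltn_mod.
  - have := interior_subset x2; rewrite -iterM -iterD.
    by rewrite -divn_eq.
have step m : (exists2 w, B w & forall j, (0 < j <= m)%N ->
     chart_close A (rho / 2 ^+ j) (iter j F w) (iter j F y0)) ->
  exists2 w, B w & forall j, (0 < j <= m.+1)%N ->
     chart_close A (rho / 2 ^+ j) (iter j F w) (iter j F y0).
  move=> [w0 Bw0 Hw0].
  (* The shadow w0 of the first m steps follows the orbit of y0 inside B, so it
     supplies the points b k of B up to step m, from which step m + 1 follows. *)
  pose c k := if (k <= q)%N then iter k F x else iter (k - q) F y0.
  pose b k := if (k <= q)%N then iter k F x else iter (k - q) F w0.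
  pose y k := if k == q then y0 else c k.
  have [||||w Hw] := Hdel q (q + m.+1)%N c b y.
  - by rewrite /c leq0n.
  - move=> k kq.
    have rr : forall x, chart_close A rho1 x x by move=> ?; apply: chart_close_refl; exact: ltW.
    rewrite /y /c /b; case: ltngtP => [kq'|kq'|->] /=.
    + split => //; exact: iB.
    + rewrite subSn 1?ltnW//.
      have cl : chart_close A rho1 (iter (k - q) F w0) (iter (k - q) F y0).
        apply: chart_close_le (Hw0 _ _).
          apply: le_trans rho_1; rewrite ler_pdivrMr ?exprn_gt0// ler_peMr//; first exact: ltW.
          by rewrite exprn_ege1// ler1n.
        by rewrite subn_gt0 kq' -ltnS ltn_subLR// ltnW.
      by split => //; exact: iB.
    + rewrite subSn// subnn /=; split => //; first exact: iB.
      by apply: (@chart_close_le _ _ _ _ _ (Num.min del rho1));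
        [rewrite ge_min lexx orbT|exact: HW].
  - by move=> k _ /negPf kq; rewrite /y kq.
  - move=> _; rewrite /y /c eqxx leqnn.
    by apply: (@chart_close_le _ _ _ _ _ (Num.min del rho1)); [rewrite ge_min lexx|exact: HW].
  (* The new shadow starts within rho of the deep point x. *)
  have Bw : B w.
    apply: Hx1; have := Hw 0%N (leq0n _); rewrite /c leq0n /= sub0n expr0 divr1.
    by move=> /chart_close_sym; exact: chart_close_le.
  exists (iter q F w); first exact: iB.
  move=> j /andP[j0 jm]; have := Hw (q + j)%N; rewrite leq_add2l => /(_ jm).
  have -> : c (q + j)%N = iter j F y0.
    by rewrite /c addKn ifF// -subn_eq0 addKn; case: j j0 {jm}.
  by rewrite [in iter _ _ w]addnC iterD addKn.
have [w Bw Hw] : exists2 w, B w & forall j, (0 < j)%N ->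
     chart_close A (rho / 2 ^+ j) (iter j F w) (iter j F y0).
  apply: (limit_shadow (rho := fun j => rho / 2 ^+ j)) => //.
    exact: C1_map_iter.
  elim=> [|m IH]; last exact: step.
  by exists z => // j; case: j.
apply: stB; exists w => //.
exact: (stable_set_of_close Cf N0 rho0 Hw).
Qed.

End RepellerIsOpen.

Theorem theorem2 (R : realType) (n : nat) (M : topologicalType)
    (X : manifold R n M) (g : riemannian X)
    (M_compact : compact [set: M]) (M_connected : connected [set: M])
    (f : M -> M) (f_axiomA : axiomA g f)
    (f_repeller : exists B : set M, repeller g f B /\ interior B !=set0) :
  anosov g f /\ transitive_on f [set: M].
Proof.
have [lf hyp _] := f_axiomA.
have [B [[[l [Om [[OmE _ OmP] [i BE]]]] WB] intB]] := f_repeller.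
have [B0 cB fB trB] := OmP i; rewrite -BE in B0 cB fB trB.
have BO : B `<=` nonwandering f by rewrite OmE BE => x Bx; exists i.
have [A] := finite_atlas_exists X M_compact.
have nB : forall z, B z -> nbhs z B.
  by apply: (repeller_nbhs A M_compact lf hyp) => //; rewrite WB.
have BT : B = [set: M].
  apply: M_connected => //.
    by exists B; rewrite ?setTI// openE.
  exists B; rewrite ?setTI//.
  exact: compact_closed (manifold_hausdorff X) cB.
have OT : nonwandering f = [set: M].
  by apply/seteqP; split => // x _; apply: BO; rewrite BT.
split; last by rewrite -BT.
split => //; have [_ _ _ [C [lam [Es [Eu [C1 lam1 HS _]]]]]] := hyp.
exists C, lam; split => // x xT; exists (Es x), (Eu x); apply: HS.
by rewrite OT.
Qed.
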